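(* Let $X$ be a toric hyper-Kähler manifold with dual $X^!$ as in the context. For any $I\in\mathbb{B}$, $$(-1)^{|I_{+}|+|I^{c}_{+}|}\cdot\mathfrak{S}_{X}(p_{I})=\sum_{\lambda\in\Xi}(-1)^{(\kappa,\lambda)}q^{\frac{1}{2}(\lambda,\lambda+\kappa)}\,i^{*}_{p^{!}_{I}}\Theta_{X^{!}}(\lambda)\cdot\Theta_{X}(\lambda),$$ where $\Xi=\mathbb{Z}^n/(\mathbb{X}^{*}(H)+\mathbb{X}_{*}(S))$, a lift $\Xi\to\mathbb{Z}^n$ is fixed and $\lambda\in\Xi$ is considered as an element of $\mathbb{Z}^n$.
   Context: Toric hyper-Kähler data. Fix $n\ge1$, $T=(\mathbb{C}^\times)^n$ and an exact sequence of algebraic tori $1\to S\to T\to H\to1$, $S\cong(\mathbb{C}^\times)^r$, $H\cong(\mathbb{C}^\times)^d$, $r+d=n$. $\mathbb{X}_*(\cdot)$, $\mathbb{X}^*(\cdot)$ are cocharacter and character lattices; $\varepsilon_1,\dots,\varepsilon_n$ is the standard basis of $\mathbb{X}_*(T)=\mathbb{Z}^n$ and $\varepsilon_i^*$ the dual basis of $\mathbb{X}^*(T)$. Let $\mathfrak{a}:\mathbb{X}_*(T)\to\mathbb{X}_*(H)$, $\mathfrak{b}:\mathbb{X}^*(T)\to\mathbb{X}^*(S)$ be the induced surjections, $\mathfrak{a}_i=\mathfrak{a}(\varepsilon_i)$, $\mathfrak{b}_i=\mathfrak{b}(\varepsilon_i^* )$; assume all $\mathfrak{a}_i\neq0$,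 $\mathfrak{b}_i\ne0$, and unimodularity: any $d$ linearly independent $\mathfrak{a}_i$'s generate $\mathbb{X}_*(H)$ over $\mathbb{Z}$. So $\mathbb{X}_*(S)=\mathrm{Ker}\,\mathfrak{a}$, $\mathbb{X}^*(H)=\mathrm{Ker}\,\mathfrak{b}$. $\mathbb{B}$ is the set of $I\subset\{1,\dots,n\}$ such that $\{\mathfrak{a}_i\}_{i\in I}$ is a basis of $\mathbb{X}_*(H)$. A signed circuit is $C=C_+\sqcup C_-$ with $\{\mathfrak{a}_i\}_{i\in C}$ minimal linearly dependent and $\sum_{C_+}\mathfrak{a}_i=\sum_{C_-}\mathfrak{a}_i$; $\beta_C=\sum_{C_+}\varepsilon_i-\sum_{C_-}\varepsilon_i\in\mathbb{X}_*(S)$. Signed cocircuits $C^\vee$ and $\alpha_{C^\vee}\in\mathbb{X}^*(H)$ are defined likewise with $\mathfrak{b}_i,\varepsilon_i^*$. For $I\in\mathbb{B}$, $j\in I^c$: $\beta^I_j=\beta_C$ for the unique signed circuit $C\subset I\cup\{j\}$ with $j\in C_+$; for $i\in I$: $\alpha^I_i=\alpha_{C^\vee}$ for the unique signed cocircuit $C^\vee\subset I^c\cup\{i\}$ with $i\in C^\vee_+$. Fix $\eta\in\mathbb{X}^*(S)$ and $\xi\in\mathbb{X}_*(H)$ with $\langle\eta,\beta_C\rangle\ne0$, $\langle\xi,\alpha_{C^\vee}\rangle\neq0$ for all $C,C^\vee$. Put $I_\pm=\{i\in I:\pm\langle\xi,\alpha^I_i\rangle>0\}$, $I^c_\pm=\{j\in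 I^c:\pm\langle\eta,\beta^I_j\rangle>0\}$. $X=\mu^{-1}(0)^{\eta\text{-ss}}/S$ is the Hamiltonian reduction of $T^*\mathbb{C}^n$ (moment map $\mu(x,y)=\sum x_iy_i\mathfrak{b}_i$), with residual action of $H$ and action of $\mathbb{S}=\mathbb{C}^\times$ by $\sigma(x,y)=(\sigma^{-1}x,\sigma^{-1}y)$. Its $H$-fixed points are $p_I$, $I\in\mathbb{B}$. $\mathcal{L}(\lambda)$ is the $H\times\mathbb{S}$-equivariant line bundle on $X$ induced from $\lambda\in\mathbb{X}^*(T)$ (trivial $\mathbb{S}$-action). Dual. Identify $\mathbb{X}^*(T)\cong\mathbb{Z}^n\cong\mathbb{X}_*(T)$ by the standard inner product $(-,-)$, so $\mathbb{X}_*(S)$ and $\mathbb{X}^*(H)$ are orthogonal sublattices of $\mathbb{Z}^n$; $\kappa=(1,\dots,1)$. $X^!$ is the toric hyper-Kähler manifold of the dual sequence $1\to H^\vee\to T^\vee\to S^\vee\to1$ with GIT parameter $\xi$ and chamber containing $\eta$; $p_I^!$ is its fixed point corresponding to $I^c$, and $\mathcal{L}^!(\lambda)$, $\lambda\in\mathbb{Z}^n$, its tautological line bundles. Equivariant parameters of $X$ are $a^\alpha$ ($\alpha\in\mathbb{X}^*(H)$) and $v$ (natural character of $\mathbb{S}$), Kähler parameters are $z^\beta$ ($\beta\in\mathbb{X}_*(S)$); for $X^!$ the roles of $a$ and $z$ are exchanged. Restrictions: $i_{p_I}^*\mathcal{L}(\lambda)=v^{\sum_{j\in I^c_+}(\lambda,\beta^I_j)-\sum_{j\in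 I^c_-}(\lambda,\beta^I_j)}a^{\lambda-\sum_{j\in I^c}(\lambda,\beta_j^I)\varepsilon_j}$, $i_{p^!_I}^*\mathcal{L}^!(\lambda)=v^{\sum_{i\in I_+}(\lambda,\alpha^I_i)-\sum_{i\in I_-}(\lambda,\alpha^I_i)}z^{\lambda-\sum_{i\in I}(\lambda,\alpha_i^I)\varepsilon_i}$. Elliptic objects. Fix $q\in\mathbb{C}$, $0<|q|<1$, $(q;q)_\infty=\prod_{m\ge1}(1-q^m)$, $\vartheta(x)=(x^{1/2}-x^{-1/2})\prod_{m\ge1}(1-q^mx)(1-q^mx^{-1})$. $\mathcal{M}$ is the field of single-valued meromorphic functions on the complex torus with coordinate functions $a^\alpha,z^\beta,v$. $\mathbf{K}(X)_{\mathrm{loc}}=\bigoplus_{I\in\mathbb{B}}\mathcal{M}$; classes built from the $\mathcal{L}(\lambda)$ and the parameters are viewed in it through their restrictions $i_{p_I}^*$. For the polarization $T^{1/2}=\sum_iv^{-1}\mathcal{L}(\varepsilon_i^* )-r\mathcal{O}_X$ and the chamber containing $\xi$, the Aganagic–Okounkov elliptic stable basis is (known explicit formula) $$\mathrm{Stab}^{AO}(p_I)=\prod_{i\in I_+}\vartheta(v^{-1}\mathcal{L}(-\varepsilon_i^* ))\prod_{i\in I_-}\vartheta(v^{-1}\mathcal{L}(\varepsilon_i^* ))\prod_{j\in I^c_+}\frac{\vartheta(v^{l_j-1}z^{\beta^I_j}\mathcal{L}(\varepsilon_j^* ))}{\vartheta(v^{l_j}z^{\beta^I_j})}\prod_{j\in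 I^c_-}\frac{\vartheta(v^{-l_j-1}z^{-\beta^I_j}\mathcal{L}(-\varepsilon_j^* ))}{\vartheta(v^{-l_j}z^{-\beta^I_j})},$$ $l_j=-\langle\beta^I_j,\kappa+\sum_{i\in I_+}\mathfrak{b}_i-\sum_{i\in I_-}\mathfrak{b}_i\rangle\pm1$ for $j\in I^c_\pm$. The elliptic standard basis is $\mathrm{Stab}^{ell}_X(p_I)=\vartheta(N^!_{p^!_I,-})\cdot\tau^*\mathrm{Stab}^{AO}(p_I)$, where $\tau^*$ is the substitution $z^\beta\mapsto v^{(\kappa,\beta)}z^\beta$ and $\vartheta(N^!_{p^!_I,-})=\prod_{j\in I^c_+}\vartheta(v^{-1}i^*_{p_I^!}\mathcal{L}^!(-\varepsilon_j))\prod_{j\in I^c_-}\vartheta(v^{-1}i^*_{p_I^!}\mathcal{L}^!(\varepsilon_j))$. Put $\mathfrak{S}_X(p_I)=\sqrt{\mathcal{L}(\kappa)\cdot i^*_{p_I^!}\mathcal{L}^!(\kappa)}^{\,-1}\mathrm{Stab}^{ell}_X(p_I)\in\mathbf{K}(X)_{\mathrm{loc}}$ (all half-integral powers cancel). For $\lambda\in\mathbb{Z}^n$: $\Theta_X(\lambda)=(q;q)_\infty^{-r}\sum_{\beta\in\mathbb{X}_*(S)}(-1)^{(\kappa,\beta)}q^{\frac12(\beta,\beta+\kappa)+(\lambda,\beta)}\mathcal{L}(\lambda+\beta)z^\beta$, $\Theta_{X^!}(\lambda)=(q;q)_\infty^{-d}\sum_{\alpha\in\mathbb{X}^*(H)}(-1)^{(\kappa,\alpha)}q^{\frac12(\alpha,\alpha+\kappa)+(\lambda,\alpha)}\mathcal{L}^!(\lambda+\alpha)a^\alpha$.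 *)

(* Defs.v *)
From HB Require Import structures.
From mathcomp Require Import all_boot all_order all_algebra finmap.
From mathcomp Require Import complex.
From mathcomp Require Import all_classical all_reals all_analysis.
From mathcomp Require Import summability.
Set Implicit Arguments.
Unset Strict Implicit.
Unset Printing Implicit Defensive.
Import Order.TTheory GRing.Theory Num.Theory numFieldNormedType.Exports.
Local Open Scope classical_set_scope.
Local Open Scope ring_scope.

(* The complex numbers, with the normed topology of a numClosedFieldType. *)
Definition CC (R : realType) : numClosedFieldType := R[i]%C.

Section Combinatorics.
Variable n : nat.
Implicit Types (k : nat) (I J : {set 'I_n}).

Definition dot (x y : 'rV[int]_n) : int := (x *m y^T) ord0 ord0.

Definition eps (i : 'I_n) : 'rV[int]_n := delta_mx ord0 i.

Definition kappa : 'rV[int]_n := const_mx 1.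

Definition supported I (c : 'rV[int]_n) : Prop :=
  forall i, i \notin I -> c ord0 i = 0.

(* A matrix M stands for the family of its n rows in Z^k, equivalently for the
   homomorphism Z^n -> Z^k, x |-> x *m M, sending eps i to row i M. *)
Definition lin_indep k (M : 'M[int]_(n, k)) I : Prop :=
  forall c, supported I c -> c *m M = 0 -> c = 0.

Definition generates k (M : 'M[int]_(n, k)) I : Prop :=
  forall h : 'rV[int]_k, exists2 c, supported I c & c *m M = h.

Definition is_basis k (M : 'M[int]_(n, k)) I : Prop :=
  lin_indep M I /\ generates M I.

Definition unimodular k (M : 'M[int]_(n, k)) : Prop :=
  forall I, #|I| = k -> lin_indep M I -> generates M I.

(* A signed circuit C is the pair (C_+, C_-). *)
Definition signed_circuit k (M : 'M[int]_(n, k))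
    (C : {set 'I_n} * {set 'I_n}) : Prop :=
  [/\ C.1 :&: C.2 = finset.set0,
      ~ lin_indep M (C.1 :|: C.2),
      forall D : {set 'I_n}, D \proper (C.1 :|: C.2) -> lin_indep M D
    & \sum_(i in C.1) row i M = \sum_(i in C.2) row i M].

Definition circuit_vec (C : {set 'I_n} * {set 'I_n}) : 'rV[int]_n :=
  \sum_(i in C.1) eps i - \sum_(i in C.2) eps i.

(* The vector of the unique signed circuit contained in j |: I with j in its
   positive part (I the index set of a basis, j outside I). *)
Definition fund_vec k (M : 'M[int]_(n, k)) I (j : 'I_n) : 'rV[int]_n :=
  circuit_vec (xget (finset.set0, finset.set0)
    [set C | [/\ signed_circuit M C, C.1 :|: C.2 \subset j |: I & j \in C.1]]).

(* Pairing of h in Z^k with an element x of the image of the injection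
   M^T : Z^k -> Z^n: x is written y *m M^T for its unique y. *)
Definition pairing k (M : 'M[int]_(n, k)) (h : 'rV[int]_k) (x : 'rV[int]_n)
  : int := (h *m (xget 0 [set y : 'rV[int]_k | x = y *m M^T])^T) ord0 ord0.

End Combinatorics.

(* Bases of the lattices of S and H are fixed, so that X_*(S) = X^*(S) = Z^r and
   X_*(H) = X^*(H) = Z^d.  The rows of amx are the a_i in X_*(H), those of bmx
   the b_i in X^*(S); X_*(S) -> Z^n is y |-> y *m bmx^T and X^*(H) -> Z^n is
   y |-> y *m amx^T. *)
Record hk_data (n d r : nat) := HkData {
  amx : 'M[int]_(n, d);
  bmx : 'M[int]_(n, r);
  eta : 'rV[int]_r;
  xi : 'rV[int]_d
}.

(* 0 -> X_*(S) -> Z^n -> X_*(H) -> 0 *)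
Definition exact_seq n d r (A : 'M[int]_(n, d)) (B : 'M[int]_(n, r)) : Prop :=
  [/\ forall y : 'rV[int]_r, y *m B^T = 0 -> y = 0,
      forall x : 'rV[int]_n,
        x *m A = 0 <-> exists y : 'rV[int]_r, x = y *m B^T
    & forall h : 'rV[int]_d, exists x : 'rV[int]_n, x *m A = h].

Record toric_hk n d r (X : hk_data n d r) : Prop := ToricHk {
  hk_n_gt0 : (0 < n)%N;
  hk_dim : (r + d)%N = n;
  hk_exact : exact_seq (amx X) (bmx X);
  hk_a_neq0 : forall i, row i (amx X) != 0;
  hk_b_neq0 : forall i, row i (bmx X) != 0;
  hk_unimodular : unimodular (amx X);
  hk_eta_generic : forall C, signed_circuit (amx X) C ->
    pairing (bmx X) (eta X) (circuit_vec C) != 0;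
  hk_xi_generic : forall C, signed_circuit (bmx X) C ->
    pairing (amx X) (xi X) (circuit_vec C) != 0
}.

Section FixedPoints.
Variables n d r : nat.
Variable X : hk_data n d r.
Implicit Types I J : {set 'I_n}.

Definition beta I j : 'rV[int]_n := fund_vec (amx X) I j.
Definition alpha I i : 'rV[int]_n := fund_vec (bmx X) (~: I) i.

(* Icp, Icm are I^c_+, I^c_- and Ip, Im are I_+, I_-. *)
Definition Icp I : {set 'I_n} :=
  [set j in ~: I | 0 < pairing (bmx X) (eta X) (beta I j)].
Definition Icm I : {set 'I_n} :=
  [set j in ~: I | 0 < - pairing (bmx X) (eta X) (beta I j)].
Definition Ip I : {set 'I_n} :=
  [set i in I | 0 < pairing (amx X) (xi X) (alpha I i)].
Definition Im I : {set 'I_n} :=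
  [set i in I | 0 < - pairing (amx X) (xi X) (alpha I i)].

(* <beta^I_j, kappa + sum_(I_+) b_i - sum_(I_-) b_i>, where kappa in X^*(T) is
   read in X^*(S) through its image kappa *m bmx; l_j is minus this, +- 1 for
   j in I^c_+-. *)
Definition lpair I j : int :=
  pairing (bmx X)
    (kappa n *m bmx X + \sum_(i in Ip I) row i (bmx X)
                      - \sum_(i in Im I) row i (bmx X))
    (beta I j).
Definition lplus I j : int := - lpair I j + 1.
Definition lminus I j : int := - lpair I j - 1.

End FixedPoints.

(* Exponents of monomials: (m, x, y) stands for v^m a^x z^y, where x ranges over
   X^*(H) = Ker b and y over X_*(S) = Ker a inside Z^n. Products of monomials
   are sums of exponents. *)
Notation weight n := (int * 'rV[int]_n * 'rV[int]_n)%type.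

Section Weights.
Variables n d r : nat.
Variable X : hk_data n d r.
Implicit Types (I J : {set 'I_n}) (lam : 'rV[int]_n).

Definition vexp (m : int) : weight n := (m, 0, 0).
Definition aexp (x : 'rV[int]_n) : weight n := (0, x, 0).
Definition zexp (y : 'rV[int]_n) : weight n := (0, 0, y).

Definition weight_lattice (w : weight n) : Prop :=
  w.1.2 *m bmx X = 0 /\ w.2 *m amx X = 0.

(* i_{p_J}^* L(lam). K(X)_loc is the direct sum over fixed points, so L(lam) is
   given there by this family of weights; likewise for the dual below. *)
Definition Lres J lam : weight n :=
  vexp (\sum_(j in Icp X J) dot lam (beta X J j)
        - \sum_(j in Icm X J) dot lam (beta X J j))
  + aexp (lam - \sum_(j in ~: J) dot lam (beta X J j) *: eps j).

(* i_{p^!_I}^* L^!(lam) *)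
Definition Ldres I lam : weight n :=
  vexp (\sum_(i in Ip X I) dot lam (alpha X I i)
        - \sum_(i in Im X I) dot lam (alpha X I i))
  + zexp (lam - \sum_(i in I) dot lam (alpha X I i) *: eps i).

End Weights.

Section Elliptic.
Variables (R : realType) (n d r : nat).
Variable X : hk_data n d r.
Variable q : CC R.
Implicit Types (I J : {set 'I_n}) (lam : 'rV[int]_n) (w : weight n).

(* A point of the torus with character lattice Z + X^*(H) + X_*(S), together
   with compatible square roots of all characters, i.e. a point of the double
   cover on which half-integral powers of monomials are functions: p w is the
   value there of the square root of the monomial w. Every homomorphism from
   this free lattice to C^* has a square root, so every point of the torus lies
   below such a p. Values of p outside the lattice are irrelevant. *)
Definition half_point (p : weight n -> CC R) : Prop :=
  (forall w, weight_lattice X w -> p w != 0) /\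
  (forall w w', weight_lattice X w -> weight_lattice X w' ->
     p (w + w') = p w * p w').

Definition mono w (p : weight n -> CC R) : CC R := p w ^+ 2.

(* An element of K(X)_loc is represented by the family, indexed by the fixed
   points J, of its components, which are functions of p. *)
Definition Kloc := {set 'I_n} -> (weight n -> CC R) -> CC R.

Definition qpoch : CC R :=
  lim ((fun N : nat => \prod_(1 <= m < N.+1) (1 - q ^+ m)) @ \oo).

(* theta(x) = (x^(1/2) - x^(-1/2)) prod_(m >= 1) (1 - q^m x) (1 - q^m / x) at the
   monomial x = w, with x^(1/2) = p w. *)
Definition theta w (p : weight n -> CC R) : CC R :=
  (p w - (p w)^-1) *
  lim ((fun N : nat => \prod_(1 <= m < N.+1)
          ((1 - q ^+ m * mono w p) * (1 - q ^+ m * (mono w p)^-1))) @ \oo).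

Definition StabAO I : Kloc := fun J p =>
  \prod_(i in Ip X I) theta (vexp n (-1) + Lres X J (- eps i)) p *
  \prod_(i in Im X I) theta (vexp n (-1) + Lres X J (eps i)) p *
  \prod_(j in Icp X I)
    (theta (vexp n (lplus X I j - 1) + zexp (beta X I j) + Lres X J (eps j)) p
     / theta (vexp n (lplus X I j) + zexp (beta X I j)) p) *
  \prod_(j in Icm X I)
    (theta (vexp n (- lminus X I j - 1) + zexp (- beta X I j)
            + Lres X J (- eps j)) p
     / theta (vexp n (- lminus X I j) + zexp (- beta X I j)) p).

(* The substitution z^y |-> v^{(kappa, y)} z^y. *)
Definition tau (p : weight n -> CC R) : weight n -> CC R :=
  fun w => p (w + vexp n (dot (kappa n) w.2)).

Definition thetaN I (p : weight n -> CC R) : CC R :=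
  \prod_(j in Icp X I) theta (vexp n (-1) + Ldres X I (- eps j)) p *
  \prod_(j in Icm X I) theta (vexp n (-1) + Ldres X I (eps j)) p.

Definition Stabell I : Kloc := fun J p => thetaN I p * StabAO I J (tau p).

Definition frakS I : Kloc := fun J p =>
  (p (Lres X J (kappa n) + Ldres X I (kappa n)))^-1 * Stabell I J p.

(* p is off the zero loci of the denominators of tau^* StabAO. Each of these is
   theta of a monomial with nontrivial z-part, so its zero locus is a proper
   divisor: an identity between meromorphic functions with these denominators
   is the identity of their values at all such p. *)
Definition regular_at I (p : weight n -> CC R) : Prop :=
  (forall j, j \in Icp X I ->
     theta (vexp n (lplus X I j) + zexp (beta X I j)) (tau p) != 0) /\
  (forall j, j \in Icm X I ->
     theta (vexp n (- lminus X I j) + zexp (- beta X I j)) (tau p) != 0).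

(* (x, x + kappa) is even, so the division is exact. *)
Definition half_norm (x : 'rV[int]_n) : int :=
  (dot x (x + kappa n) %/ 2)%Z.

(* Unconditional sum over the sublattice Ker M of Z^n. *)
Definition sum_ker k (M : 'M[int]_(n, k)) (F : 'rV[int]_n -> CC R) : CC R :=
  summability.sum (fun x => if x *m M == 0 then F x else 0).

Definition ThetaX lam : Kloc := fun J p =>
  qpoch ^- r * sum_ker (amx X) (fun b =>
    (-1) ^ dot (kappa n) b * q ^ (half_norm b + dot lam b)
    * mono (Lres X J (lam + b)) p * mono (zexp b) p).

(* i_{p^!_I}^* Theta_{X^!}(lam) *)
Definition ThetaXd_res I lam (p : weight n -> CC R) : CC R :=
  qpoch ^- d * sum_ker (bmx X) (fun a =>
    (-1) ^ dot (kappa n) a * q ^ (half_norm a + dot lam a)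
    * mono (Ldres X I (lam + a)) p * mono (aexp a) p).

End Elliptic.

(* x in X^*(H) + X_*(S) *)
Definition in_sum_lattice n d r (X : hk_data n d r) (x : 'rV[int]_n) : Prop :=
  exists a b : 'rV[int]_n, [/\ a *m bmx X = 0, b *m amx X = 0 & x = a + b].

(* A section Xi -> Z^n of the quotient Xi = Z^n / (X^*(H) + X_*(S)), composed
   with the projection Z^n -> Xi. Its range is the set of chosen lifts. *)
Definition is_lift n d r (X : hk_data n d r)
    (l : 'rV[int]_n -> 'rV[int]_n) : Prop :=
  (forall x, in_sum_lattice X (x - l x)) /\
  (forall x y, in_sum_lattice X (x - y) -> l x = l y).

(* Main.v *)
Require Import Defs.
From mathcomp Require Import all_boot all_order all_algebra finmap.
From mathcomp Require Import complex.
From mathcomp Require Import all_classical all_reals all_analysis.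
From mathcomp Require Import summability ring lra zify.

(** Both sides are the same product of theta functions. Let I label the class,
    J the fixed point at which it is restricted, and let
    w_i = i_{p_J}^* L(eps_i) * i_{p^!_I}^* L^!(eps_i), for i = 1, ..., n.

    Right-hand side. The sublattices Ker b = X^*(H) and Ker a = X_*(S) of Z^n are
    orthogonal complements of each other, of finite index together, so that every
    mu in Z^n is lam + alpha + beta for exactly one lift lam of a class of Xi and
    one alpha in Ker b, beta in Ker a. The quadratic form (mu, mu + kappa) / 2
    then splits without cross terms between alpha and beta, L(alpha) restricts to
    a^alpha, and L^!(beta) to z^beta. Hence the sum over lam of products of two
    theta series is a single absolutely convergent series over Z^n
    (sum_lattice_split, lattice_term_split), whose term at mu is the product over
    i of (-1)^mu_i q^(mu_i (mu_i + 1) / 2) w_i^mu_i. It factors into n series over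
    Z (lattice_product), each evaluated by the Jacobi triple product: the right
    side is the product over i of w_i^(-1/2) theta(w_i).

    Left-hand side. The square root in the definition of S_X(p_I) contributes the
    product of the w_i^(-1/2). By orthogonality, alpha^I_i has coordinate
    -(beta^I_j)_i at j (alpha_beta). So L^!(eps_i) restricts to v or v^-1 for i in I_+
    or I_-, and for j outside I it restricts to v^(l_j -+ 1 + (kappa, beta_j))
    z^(beta_j). With these weights the numerators of tau^* StabAO are, up to the
    oddness of theta, the theta(w_i), and its denominators cancel the normal
    factor theta(N^!_{p^!_I, -}) (theta_Ip, theta_Im, theta_Icp, theta_Icm). Each
    index of I_+ and of I^c_+ contributes a sign.

    Fundamental circuits and cocircuits exist because unimodularity forces the
    coordinates of each a_j in a basis to be 0, 1 or -1 (coordinate_sign). *)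

Set Implicit Arguments.
Unset Strict Implicit.
Unset Printing Implicit Defensive.
Import Order.TTheory GRing.Theory Num.Theory numFieldNormedType.Exports.
Local Open Scope classical_set_scope.
Local Open Scope ring_scope.

(** * The modulus of a complex number as a real number *)

Section ComplexModulus.
Variable R : realType.
Implicit Types z w : CC R.

(** The norm of CC R takes its values in CC R; estimates are made in R, where
    the order is total. *)
Definition cabs z : R := complex.Re `|z|.

Lemma normE z : `|z| = (cabs z)%:C%C.
Proof. by rewrite /cabs; have := normr_real z; move=> /RRe_real ->. Qed.

Lemma cabsE (x : R) : 0 <= x -> cabs x%:C%C = x.
Proof. by move=> x0; rewrite /cabs normc_def /= expr0n addr0 sqrtr_sqr ger0_norm. Qed.

Lemma cabs_ge0 z : 0 <= cabs z.
Proof. by rewrite -(@ler0c R) -normE normr_ge0. Qed.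

Lemma cabsM z w : cabs (z * w) = cabs z * cabs w.
Proof. by apply: (@complexI R); rewrite rmorphM /= -!normE normrM. Qed.

Lemma cabsD z w : cabs (z + w) <= cabs z + cabs w.
Proof. by rewrite -(@lecR R) rmorphD /= -!normE; exact: ler_normD. Qed.

Lemma cabsN z : cabs (- z) = cabs z.
Proof. by rewrite /cabs normrN. Qed.

Lemma cabs0 : cabs 0 = 0.
Proof. by rewrite /cabs normr0. Qed.

Lemma cabs1 : cabs 1 = 1.
Proof. by rewrite /cabs normr1. Qed.

Lemma cabs_eq0 z : (cabs z == 0) = (z == 0).
Proof. by rewrite -(inj_eq (@complexI R)) /= -normE normr_eq0. Qed.

Lemma cabsV z : cabs z^-1 = (cabs z)^-1.
Proof. by apply: (@complexI R); rewrite fmorphV /= -!normE normfV. Qed.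

Lemma cabsX z k : cabs (z ^+ k) = cabs z ^+ k.
Proof. by elim: k => [|k IH]; rewrite ?expr0 ?cabs1 // !exprS cabsM IH. Qed.

Lemma cabs_sum (T : Type) (s : seq T) (P : pred T) (f : T -> CC R) :
  cabs (\sum_(x <- s | P x) f x) <= \sum_(x <- s | P x) cabs (f x).
Proof.
elim/big_ind2: _ => [|a x b y ha hb|//]; first by rewrite cabs0.
exact: le_trans (cabsD _ _) (lerD ha hb).
Qed.

Lemma cabs_prod (T : Type) (s : seq T) (P : pred T) (f : T -> CC R) :
  cabs (\prod_(x <- s | P x) f x) = \prod_(x <- s | P x) cabs (f x).
Proof. by elim/big_ind2: _ => [|a x b y <- <-|//]; rewrite ?cabs1 ?cabsM. Qed.

Lemma cvg_cabsP (T : Type) (F : set_system T) (FF : Filter F) (f : T -> CC R) l :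
  f @ F --> l <-> forall e : R, 0 < e -> \forall x \near F, cabs (l - f x) < e.
Proof.
split=> [/cvgrPdist_lt fl e e0|fl].
  have /fl : 0 < (e%:C%C : CC R) by rewrite (@ltcR R 0).
  by apply: filterS => x; rewrite normE (@ltcR R).
apply/cvgrPdist_lt => e e0.
have er : (complex.Re e)%:C%C = e by rewrite RRe_real // gtr0_real.
have /fl : 0 < complex.Re e by rewrite -(@ltcR R) er.
by apply: filterS => x; rewrite normE -er (@ltcR R).
Qed.

Lemma eq_cvg_to (T : Type) (F : set_system T) (f g : T -> CC R) (l : CC R) :
  f =1 g -> g @ F --> l -> f @ F --> l.
Proof. by move=> /funext ->. Qed.

End ComplexModulus.

(** * Unconditional summation *)

#[local] Existing Instance summability.totally_filter.

Section AbsoluteSummability.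
Variable R : realType.

Definition abs_summable (T : choiceType) (f : T -> CC R) : Prop :=
  exists M : R, forall s : seq T, uniq s -> \sum_(x <- s) cabs (f x) <= M.

(** Cofinality of a sequence of finite sets among all finite sets, tested on
    points. *)
Definition exhausts (T : choiceType) (D : nat -> seq T) : Prop :=
  (forall N, uniq (D N)) /\ (forall x, \forall N \near \oo, x \in D N).

(** A bounded increasing net of reals converges to its supremum. *)
Lemma nonneg_cvg_totally (T : choiceType) (g : T -> R) (M : R) :
  (forall x, 0 <= g x) ->
  (forall s : seq T, uniq s -> \sum_(x <- s) g x <= M) ->
  exists l : R,
    partial_sum (fun x => (g x)%:C%C : CC R) @ totally --> (l%:C%C : CC R).
Proof.
move=> g0 gM; pose E := [set \sum_(x <- enum_fset A) g x | A in @setT {fset T}].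
have supE : has_sup E.
  split; first by exists (\sum_(x <- enum_fset (fset0 : {fset T})) g x), fset0.
  by exists M => _ [A _ <-]; apply: gM; exact: fset_uniq.
exists (sup E); apply/cvg_cabsP => e e0.
have [_ [A _ <-] hA] := sup_adherent e0 supE.
exists A => // B /= AB.
have leB : \sum_(x <- enum_fset B) g x <= sup E.
  by apply: ub_le_sup; [exact: supE.2|exists B].
have leAB : \sum_(x <- enum_fset A) g x <= \sum_(x <- enum_fset B) g x.
  rewrite [leRHS](big_fsetID _ (mem A)) /= ler_wpDr ?sumr_ge0 //.
  rewrite le_eqVlt; apply/orP; left; apply/eqP/perm_big/uniq_perm => //.
  move=> x; rewrite !inE /=; apply/idP/andP => [xA|[]//]; split=> //.
  exact: (fsubsetP AB).
rewrite /partial_sum -(big_seq_fsetE _ B xpredT (fun x => (g x)%:C%C)).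
rewrite -rmorph_sum -rmorphB /= cabsE ?subr_ge0 //.
by rewrite ltrBlDr addrC -ltrBlDr (lt_le_trans hA).
Qed.

(** Splitting into the positive and negative parts of the real and imaginary
    parts reduces the claim to nonnegative families. *)
Lemma abs_summable_cvg (T : choiceType) (f : T -> CC R) :
  abs_summable f -> cvg (partial_sum f @ totally).
Proof.
move=> [M fM].
have part (u : T -> R) : (forall x, `|u x| <= cabs (f x)) ->
    exists l : CC R, partial_sum (fun x => (u x)%:C%C : CC R) @ totally --> l.
  move=> uf; have pos (g : T -> R) : (forall x, 0 <= g x <= `|u x|) ->
    exists l : CC R, partial_sum (fun x => (g x)%:C%C : CC R) @ totally --> l.
    move=> gu; have [||l ?] := @nonneg_cvg_totally T g M; last by exists l%:C%C.
    + by move=> x; case/andP: (gu x).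
    + move=> s /fM; apply: le_trans; apply: ler_sum => x _.
      by apply: le_trans (uf x); case/andP: (gu x).
  have [x|l lP] := pos (fun x => (`|u x| + u x) / 2).
    by have := ler_norm (u x); have := lerNnormlW (lexx `|u x|); lra.
  have [x|m mP] := pos (fun x => (`|u x| - u x) / 2).
    by have := ler_norm (u x); have := lerNnormlW (lexx `|u x|); lra.
  exists (l - m).
  apply: (eq_cvg_to (g := fun A => partial_sum (fun x => ((`|u x| + u x) / 2)%:C%C : CC R) A
    - partial_sum (fun x => ((`|u x| - u x) / 2)%:C%C : CC R) A)); last exact: (cvgB lP mP).
  move=> A; rewrite /partial_sum /= -sumrB; apply: eq_bigr => x _.
  by rewrite -rmorphB /=; congr (_%:C%C); lra.
have normle x : `|complex.Re (f x)| <= cabs (f x) /\ `|complex.Im (f x)| <= cabs (f x).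
  rewrite -!(@lecR R) -!normE.
  rewrite !normc_def !lecR -!sqrtr_sqr.
  by split; apply: ler_wsqrtr; rewrite ?lerDl ?lerDr sqr_ge0.
have [x|l lP] := part (fun x => complex.Re (f x)); first by case: (normle x).
have [x|m mP] := part (fun x => complex.Im (f x)); first by case: (normle x).
apply/cvg_ex; exists (l + 'i%C * m).
apply: (eq_cvg_to (g := fun A => partial_sum (fun x => (complex.Re (f x))%:C%C : CC R) A
    + ('i%C : CC R) * partial_sum (fun x => (complex.Im (f x))%:C%C : CC R) A)); last first.
  apply: (cvgD lP); apply: cvgM mP; exact: cvg_cst.
move=> A; rewrite /partial_sum /= mulr_sumr -big_split /=.
by apply: eq_bigr => x _; rewrite -complexE.
Qed.

Lemma near_all_seq (T : eqType) (P : nat -> T -> Prop) (s : seq T) :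
  (forall x, \forall N \near \oo, P N x) ->
  \forall N \near \oo, forall x, x \in s -> P N x.
Proof.
move=> nP; elim: s => [|x s IH]; first by near=> N.
apply: filterS (filterI (nP x) IH) => N [Px Ps] y.
by rewrite inE => /predU1P[->|/Ps].
Unshelve. all: by end_near. Qed.

(** The unconditional sum can be computed along any exhaustion, which is cofinal
    among finite sets. Every identity between sums below is proved by choosing
    an exhaustion along which the partial sums agree. *)
Lemma sum_exhaust (T : choiceType) (f : T -> CC R) (D : nat -> seq T) :
  abs_summable f -> exhausts D ->
  \sum_(x <- D N) f x @[N --> \oo] --> summability.sum f.
Proof.
move=> /abs_summable_cvg fc Dex.
have -> : (fun N => \sum_(x <- D N) f x) =
    (partial_sum f) \o (fun N => [fset x in D N]%fset).
  apply/funext => N /=; rewrite /partial_sum.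
  rewrite -(big_seq_fsetE _ [fset x in D N]%fset xpredT f).
  apply: perm_big; apply: uniq_perm; rewrite ?fset_uniq //; first exact: Dex.1.
  by move=> x; rewrite !inE.
apply: cvg_comp; last exact: fc.
move=> P [A _ AP]; have := near_all_seq (enum_fset A) Dex.2; apply: filterS => N AN.
by apply: AP; apply/fsubsetP => x /AN xN /=; rewrite !inE.
Qed.

End AbsoluteSummability.

Section SummationTools.
Variable R : realType.

Lemma ler_sum_subset (T : eqType) (s t : seq T) (g : T -> R) :
  (forall x, 0 <= g x) -> uniq s -> uniq t -> {subset s <= t} ->
  \sum_(x <- s) g x <= \sum_(x <- t) g x.
Proof.
move=> g0 us ut st; rewrite [leRHS](bigID (mem s)) /= ler_wpDr ?sumr_ge0 //.
rewrite le_eqVlt; apply/orP; left; apply/eqP; rewrite -[RHS]big_filter.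
apply/perm_big/uniq_perm; rewrite ?filter_uniq // => x; rewrite mem_filter.
by apply/idP/andP => [xs|[]//]; split=> //; exact: st.
Qed.

Lemma exhausts_abs_summable (T : choiceType) (f : T -> CC R) (D : nat -> seq T) M :
  exhausts D -> (forall N, \sum_(x <- D N) cabs (f x) <= M) -> abs_summable f.
Proof.
move=> Dex fM; exists M => s us.
have [N _ /(_ N (leqnn N)) sD] := near_all_seq s Dex.2.
apply: le_trans (fM N); apply: ler_sum_subset => // [x|]; first exact: cabs_ge0.
exact: Dex.1.
Qed.

Lemma abs_summable_comp (T U : choiceType) (f : T -> CC R) (g : U -> CC R)
    (phi : U -> T) (k : R) :
  injective phi -> 0 <= k -> (forall x, cabs (g x) <= k * cabs (f (phi x))) ->
  abs_summable f -> abs_summable g.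
Proof.
move=> inj k0 gf [M fM]; exists (k * M) => s us.
apply: (@le_trans _ _ (k * \sum_(x <- map phi s) cabs (f x))).
  by rewrite big_map mulr_sumr; apply: ler_sum.
by rewrite ler_wpM2l // fM // map_inj_uniq.
Qed.

Lemma exhausts_iota : exhausts (iota 0).
Proof.
split=> [N|x]; first exact: iota_uniq.
by exists x.+1 => // N /= xN; rewrite mem_iota.
Qed.

(** Dominated convergence for unconditional sums: outside a finite set s the
    family t has small mass, and on s convergence is uniform. *)
Lemma tannery (T : choiceType) (t : T -> CC R) (c : nat -> T -> CC R)
    (D : nat -> seq T) (K : R) (l : CC R) :
  abs_summable t -> exhausts D -> (forall N x, cabs (c N x) <= K) ->
  (forall x, c N x @[N --> \oo] --> l) ->
  \sum_(x <- D N) c N x * t x @[N --> \oo] --> l * summability.sum t.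
Proof.
move=> tS Dex cK cl; have tD := sum_exhaust tS Dex.
apply: (eq_cvg_to (g := fun N => l * (\sum_(x <- D N) t x) +
   \sum_(x <- D N) (c N x - l) * t x)).
  move=> N; rewrite mulr_sumr -big_split /=; apply: eq_bigr => x _; ring.
rewrite -[X in _ --> X]addr0; apply: cvgD.
  by apply: cvgM tD; exact: cvg_cst.
have [M tM] := tS; pose K' := `|K| + cabs l.
have K'0 : 0 <= K' by rewrite addr_ge0 ?cabs_ge0.
have cK' N x : cabs (c N x - l) <= K'.
  apply: le_trans (cabsD _ _) _; rewrite cabsN lerD2r.
  exact: le_trans (cK N x) (ler_norm K).
pose E := [set \sum_(x <- s) cabs (t x) | s in [set s : seq T | uniq s]].
have supE : has_sup E.
  split; first by exists (\sum_(x <- [::]) cabs (t x)), [::].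
  by exists M => _ [s us <-]; exact: tM.
apply/cvg_cabsP => e e0; pose d := e / (2 * (K' + M + 1)).
have M0 : 0 <= M by have := tM [::] isT; rewrite big_nil.
have KM0 : 0 < 2 * (K' + M + 1) by lra.
have d0 : 0 < d by rewrite divr_gt0.
have [_ [s us <-] hs] := sup_adherent d0 supE.
(* s carries all but d of the mass of t *)
have cs : \forall N \near \oo, forall x, x \in s -> cabs (c N x - l) < d.
  apply: near_all_seq => x; have /cvg_cabsP /(_ d d0) := cl x.
  by apply: filterS => N; rewrite -cabsN opprB.
apply: filterS cs => N cs; rewrite sub0r cabsN.
apply: le_lt_trans (cabs_sum _ _ _) _; rewrite (bigID (mem s)) /=.
have head : \sum_(x <- D N | x \in s) cabs ((c N x - l) * t x) <= d * M.
  apply: (@le_trans _ _ (\sum_(x <- D N | x \in s) d * cabs (t x))).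
    by apply: ler_sum => x xs; rewrite cabsM ler_wpM2r ?cabs_ge0 // ltW // cs.
  rewrite -mulr_sumr ler_wpM2l ?(ltW d0) // -big_filter tM //.
  exact/filter_uniq/Dex.1.
have tail : \sum_(x <- D N | x \notin s) cabs ((c N x - l) * t x) <= K' * d.
  apply: (@le_trans _ _ (\sum_(x <- D N | x \notin s) K' * cabs (t x))).
    by apply: ler_sum => x xs; rewrite cabsM ler_wpM2r ?cabs_ge0.
  rewrite -mulr_sumr ler_wpM2l // -big_filter; set s' := [seq x <- _ | _].
  have : \sum_(x <- s ++ s') cabs (t x) <= sup E.
    apply: ub_le_sup; first exact: supE.2.
    exists (s ++ s') => //=; rewrite cat_uniq us filter_uniq ?andbT /=; last exact: Dex.1.
    by apply/hasPn => x; rewrite mem_filter => /andP[].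
  by rewrite big_cat /=; lra.
have -> : e = d * (2 * (K' + M + 1)).
  by rewrite divfK // gt_eqF.
apply: le_lt_trans (lerD head tail) _; rewrite mulrC -mulrDl mulrC ltr_pM2l //.
by lra.
Qed.

(** Steps bounded by a geometric progression are absolutely summable, and the
    sequence is the sequence of their partial sums. *)
Lemma geometric_steps_cvg (x : nat -> CC R) (M rho : R) :
  0 <= M -> 0 <= rho < 1 -> (forall N, cabs (x N.+1 - x N) <= M * rho ^+ N) ->
  cvg (x @ \oo).
Proof.
move=> M0 /andP[rho0 rho1] xM; pose f N := x N.+1 - x N.
have fS : abs_summable f.
  apply: (exhausts_abs_summable (M := M / (1 - rho)) exhausts_iota) => N.
  apply: le_trans (ler_sum _ (fun i _ => xM i)) _.
  rewrite -mulr_sumr ler_wpM2l //.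
  have := subrX1 rho N; rewrite -(big_mkord xpredT (fun i => rho ^+ i)) /index_iota subn0.
  set S := \sum_(_ <- _) _ => eS.
  rewrite -(ler_pM2l (x := 1 - rho)) ?subr_gt0 // mulfV ?gt_eqF ?subr_gt0 //.
  by have := exprn_ge0 N rho0; lra.
apply/cvg_ex; exists (x 0%N + summability.sum f).
apply: (eq_cvg_to (g := fun N => x 0%N + \sum_(i <- iota 0 N) f i)).
  move=> N; have := telescope_sumr x (leq0n N); rewrite /index_iota subn0 => ->.
  by rewrite addrC subrK.
apply: cvgD (sum_exhaust fS exhausts_iota); exact: cvg_cst.
Qed.

(** Ratio test: from m0 on, S m + 2 |u m| does not increase, S being the
    partial sums of |u|. *)
Lemma ratio_abs_summable (u : nat -> CC R) m0 :
  (forall m, (m0 <= m)%N -> cabs (u m.+1) <= cabs (u m) / 2) -> abs_summable u.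
Proof.
move=> um; pose S m := \sum_(i <- iota 0 m) cabs (u i).
have SS m : S m.+1 = S m + cabs (u m).
  by rewrite /S -addn1 iotaD big_cat big_seq1.
have Smono m k : S m <= S (m + k)%N.
  elim: k => [|k IH]; first by rewrite addn0.
  by rewrite addnS SS; have := cabs_ge0 (u (m + k)%N); lra.
have bound k : S (m0 + k)%N + 2 * cabs (u (m0 + k)%N) <= S m0 + 2 * cabs (u m0).
  elim: k => [|k IH]; first by rewrite addn0.
  by rewrite addnS SS; have := um (m0 + k)%N (leq_addr _ _); lra.
apply: (exhausts_abs_summable (M := S m0 + 2 * cabs (u m0)) exhausts_iota) => N.
have := bound N; have := Smono N m0; rewrite addnC /S.
by have := cabs_ge0 (u (N + m0)%N); rewrite addnC; lra.
Qed.

End SummationTools.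

(** * The q-binomial theorem *)

Section QBinomial.
Variables (F : fieldType) (q : F).

Definition qfact (N : nat) : F := \prod_(1 <= m < N.+1) (1 - q ^+ m).

(** Gaussian binomial coefficients, defined by the q-Pascal rule so that no
    division is involved and they vanish for k > M. *)
Fixpoint qbin (M k : nat) : F :=
  match k, M with
  | 0, _ => 1
  | _.+1, 0 => 0
  | k'.+1, M'.+1 => qbin M' k + q ^+ (M' - k') * qbin M' k'
  end.

Lemma qfact0 : qfact 0 = 1.
Proof. by rewrite /qfact big_nil. Qed.

Lemma qfactS N : qfact N.+1 = qfact N * (1 - q ^+ N.+1).
Proof. by rewrite /qfact big_nat_recr. Qed.

Lemma qbin0 M : qbin M 0 = 1.
Proof. by case: M. Qed.

Lemma qbinS M k : qbin M.+1 k.+1 = qbin M k.+1 + q ^+ (M - k) * qbin M k.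
Proof. by []. Qed.

Lemma qbin_small M k : (M < k)%N -> qbin M k = 0.
Proof.
elim: M k => [|M IH] [|k] //; rewrite ltnS qbinS => Mk.
by rewrite !IH ?mulr0 ?addr0 // ltnW.
Qed.

Lemma qbin_qfact M k : (k <= M)%N -> qbin M k * (qfact k * qfact (M - k)) = qfact M.
Proof.
elim: M k => [|M IH] [|k] //; rewrite ?qbin0 ?qfact0 ?subn0 ?mul1r //.
rewrite ltnS leq_eqVlt qbinS subSS => /predU1P[->|kM].
  rewrite qbin_small // subnn qfact0 add0r expr0 mul1r mulr1 !qfactS mulrA.
  by have := IH M (leqnn M); rewrite subnn qfact0 mulr1 => ->.
have e1 := IH k.+1 kM; have e2 := IH k (ltnW kM).
have e : (M - k = (M - k.+1).+1)%N by rewrite subnSK.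
have eM : (M.+1 = (M - k) + k.+1)%N by rewrite addnS subnK // ltnW.
have e3 : q ^+ M.+1 = q ^+ (M - k) * q ^+ k.+1 by rewrite -exprD -eM.
have f1 : qfact (M - k) = qfact (M - k.+1) * (1 - q ^+ (M - k)) by rewrite {1}e qfactS -e.
rewrite [RHS]qfactS e3 mulrDl.
transitivity ((1 - q ^+ (M - k)) * qfact M +
  q ^+ (M - k) * (1 - q ^+ k.+1) * qfact M); last by ring.
congr (_ + _); first by rewrite -e1 f1; ring.
by rewrite -e2 qfactS; ring.
Qed.

(** The q-Pascal rule splits off the last factor 1 + y q^M. *)
Lemma qbinomial_theorem M y :
  \prod_(0 <= m < M) (1 + y * q ^+ m) =
  \sum_(0 <= k < M.+1) q ^+ 'C(k, 2) * qbin M k * y ^+ k.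
Proof.
elim: M => [|M IH]; first by rewrite big_nil big_nat1 bin0n expr0 qbin0 !mulr1.
rewrite big_nat_recr //= IH mulrDr mulr1.
rewrite [RHS]big_nat_recl //= bin0n expr0 !mulr1.
under [in RHS]eq_bigr => k _ do rewrite mulrDr mulrDl.
rewrite big_split /= addrA; congr (_ + _).
  transitivity (\sum_(0 <= k < M.+2) q ^+ 'C(k, 2) * qbin M k * y ^+ k).
    by rewrite [RHS]big_nat_recr //= qbin_small // mulr0 mul0r addr0.
  by rewrite [LHS]big_nat_recl //= qbin0 bin0n expr0 !mulr1.
rewrite mulr_suml; apply: eq_big_nat => k /andP[_ kM].
have -> : q ^+ M = q ^+ (M - k) * q ^+ k by rewrite -exprD subnK.
by rewrite binS bin1 exprD exprS; ring.
Qed.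

End QBinomial.

(** * The Jacobi triple product *)

Section IntegerWindows.
Implicit Types m : int.

(** Triangular numbers, extended to negative indices. *)
Definition tri m : int := (m * (m + 1) %/ 2)%Z.

Lemma tri2 m : tri m * 2 = m * (m + 1).
Proof.
rewrite /tri divzK //; have [k ->] : exists k : int, m * (m + 1) = k * 2; last exact: dvdz_mull.
have -> : m = (m %/ 2)%Z * 2 + (m %% 2)%Z by exact: divz_eq.
have : (m %% 2)%Z = 0 \/ (m %% 2)%Z = 1.
  have := modz_ge0 m (isT : (2 : int) != 0); have := ltz_mod m (isT : (2 : int) != 0); lia.
move=> [] ->; first by exists ((m %/ 2)%Z * ((m %/ 2)%Z * 2 + 1)); ring.
by exists (((m %/ 2)%Z * 2 + 1) * ((m %/ 2)%Z + 1)); ring.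
Qed.

Lemma triS m : tri (m + 1) = tri m + (m + 1).
Proof. have := tri2 m; have := tri2 (m + 1); nia. Qed.

(** Symmetric, to match the 2N factors of the finite triple product. *)
Definition window (N : nat) : seq int := [seq k%:Z - N%:Z | k <- iota 0 (2 * N).+1].

Lemma exhausts_window : exhausts window.
Proof.
split=> [N|m]; first by rewrite map_inj_uniq ?iota_uniq // => i j; lia.
exists (absz m) => // N /= mN; apply/mapP; exists (absz (m + N%:Z)); last by lia.
by rewrite mem_iota; lia.
Qed.

End IntegerWindows.

Section JacobiTripleProduct.
Variables (R : realType) (q : CC R).
Hypotheses (q_neq0 : q != 0) (q_lt1 : cabs q < 1).
Implicit Types (x : CC R) (m l : int).

(** The general term of the series whose sum is the Jacobi triple product. *)
Definition jterm x m : CC R := (-1) ^ m * q ^ tri m * x ^ m.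

Lemma jtermS x m : x != 0 -> jterm x (m + 1) = - (q ^ (m + 1) * x) * jterm x m.
Proof.
move=> x0; rewrite /jterm triS !expfzDr ?oppr_eq0 ?oner_eq0 //.
by rewrite !expr1z; move: (q ^ _) (q ^ _) (x ^ _) ((-1) ^ _) => *; ring.
Qed.

Lemma jterm0 x : jterm x 0 = 1.
Proof. by rewrite /jterm /tri mul0r div0z !expr0z !mulr1. Qed.

(** The q-binomial theorem with 2N factors and y = -x q^(1-N), centred by
    extracting -x / q^m from each of the first N factors. *)
Lemma finite_jacobi N x : x != 0 ->
  \prod_(0 <= m < N) ((1 - q ^+ m.+1 * x) * (1 - q ^+ m * x^-1)) =
  \sum_(l <- window N) qbin q (2 * N) (absz (l + N%:Z)) * jterm x l.
Proof.
move=> x0; have qX0 k : q ^+ k != 0 by rewrite expf_neq0.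
pose y := - (x * q / q ^+ N); pose P := \prod_(0 <= m < N) (- (x / q ^+ m)).
have P0 : P != 0.
  by rewrite prodf_seq_neq0; apply/allP => m _; rewrite /= oppr_eq0 mulf_neq0 ?invr_eq0.
have lhs : \prod_(0 <= m < 2 * N) (1 + y * q ^+ m) =
    P * \prod_(0 <= m < N) ((1 - q ^+ m.+1 * x) * (1 - q ^+ m * x^-1)).
  rewrite (@big_cat_nat _ _ _ N) /=; [|lia|lia]; rewrite big_split /= mulrCA mulrC.
  congr (_ * _).
    rewrite -{1}[N]add0n big_addn (_ : (2 * N - N = N)%N); last by lia.
    apply: eq_bigr => m _; rewrite /y exprD exprS; congr (1 + _).
    by field; rewrite qX0.
  rewrite -big_split /= big_nat_rev /= add0n; apply: eq_big_nat => m /andP[_ mN].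
  have -> : q ^+ (N - m.+1) = q ^+ N / q ^+ m.+1.
    by apply: (mulIf (qX0 m.+1)); rewrite divfK // -exprD subnK.
  by rewrite /y exprS; field; rewrite !qX0 x0 q_neq0.
have E k : q ^+ 'C(k, 2) * y ^+ k = P * jterm x (k%:Z - N%:Z).
  (* both sides satisfy the recursion of jterm in k, and in N when k = 0 *)
  elim: k => [|k IH].
    rewrite bin0n expr0 mulr1 sub0r /P; elim: (N) => [|n IHn].
      by rewrite big_nil oppr0 jterm0 mulr1.
    rewrite big_nat_recr //= {1}IHn -mulrA; congr (_ * _).
    rewrite (_ : - n%:Z = - n.+1%:Z + 1) ?jtermS //; last by lia.
    rewrite (_ : - n.+1%:Z + 1 = - n%:Z); last by lia.
    by rewrite -exprnN; field.
  rewrite (_ : k.+1%:Z - N%:Z = (k%:Z - N%:Z) + 1); last by lia.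
  rewrite jtermS // mulrCA -IH binS bin1 exprD exprS /y.
  rewrite !expfzDr // expr1z -exprnN -exprnP; by field.
apply: (mulfI P0); rewrite -lhs qbinomial_theorem /window big_map /index_iota subn0 mulr_sumr.
apply: eq_bigr => k _; rewrite subrK absz_nat mulrAC E; ring.
Qed.

Let rho := cabs q.

Lemma rho_gt0 : 0 < rho.
Proof. by rewrite lt_neqAle cabs_ge0 andbT eq_sym cabs_eq0. Qed.

Lemma powers_cvg0 : q ^+ N @[N --> \oo] --> (0 : CC R).
Proof.
apply/cvg_cabsP => e e0; have : `|rho| < 1 by rewrite ger0_norm ?cabs_ge0.
move=> /cvg_expr /cvgrPdist_lt /(_ _ e0); apply: filterS => N.
by rewrite !sub0r cabsN normrN cabsX ger0_norm // exprn_ge0 ?cabs_ge0.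
Qed.

Lemma powers_le_half (c : R) : exists m0 : nat,
  forall k, (m0 <= k)%N -> rho ^+ k.+1 * c <= 2^-1.
Proof.
have d0 : 0 < (2 * (`|c| + 1))^-1 by rewrite invr_gt0; have := normr_ge0 c; lra.
have /cvg_cabsP /(_ _ d0) [m0 _ hm] := powers_cvg0.
exists m0 => k mk; have := hm k.+1 (leqW mk).
rewrite /= sub0r cabsN cabsX -/rho => /ltW kd.
apply: (@le_trans _ _ (rho ^+ k.+1 * (`|c| + 1))).
  rewrite ler_wpM2l ?exprn_ge0 ?cabs_ge0 //; have := ler_norm c; lra.
apply: (@le_trans _ _ ((2 * (`|c| + 1))^-1 * (`|c| + 1))).
  by rewrite ler_wpM2r // addr_ge0.
by rewrite invfM -mulrA mulVf ?mulr1 // gt_eqF //; have := normr_ge0 c; lra.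
Qed.

(** Both half-series pass the ratio test, as q^k tends to 0. *)
Lemma jterm_abs_summable x : x != 0 -> abs_summable (jterm x).
Proof.
move=> x0; have [m1 h1] := powers_le_half (cabs x); have [m2 h2] := powers_le_half (cabs x)^-1.
have [|M1 b1] := @ratio_abs_summable R (fun k : nat => jterm x k%:Z) m1.
  move=> k /h1 hk; rewrite -addn1 PoszD jtermS // cabsM cabsN cabsM mulrC.
  rewrite ler_wpM2l ?cabs_ge0 //.
  by rewrite -PoszD addn1 -exprnP cabsX.
have [|M2 b2] := @ratio_abs_summable R (fun k : nat => jterm x (Negz k)) m2.
  move=> k /h2 hk; have e : Negz k = Negz k.+1 + 1 by lia.
  have -> : cabs (jterm x (Negz k)) = (rho ^+ k.+1)^-1 * cabs x * cabs (jterm x (Negz k.+1)).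
    by rewrite {1}e jtermS // -e NegzE -exprnN cabsM cabsN cabsM cabsV cabsX.
  have rk : 0 < rho ^+ k.+1 by rewrite exprn_gt0 ?rho_gt0.
  have cx : 0 < cabs x by rewrite lt_neqAle cabs_ge0 andbT eq_sym cabs_eq0.
  set T := cabs _; rewrite mulrC.
  have {1}-> : T = rho ^+ k.+1 * (cabs x)^-1 * ((rho ^+ k.+1)^-1 * cabs x * T).
    by field; rewrite !gt_eqF.
  by rewrite ler_wpM2r // !mulr_ge0 ?cabs_ge0 // invr_ge0 ltW.
have Dex : exhausts (fun N => map Posz (iota 0 N) ++ map Negz (iota 0 N)).
  split=> [N|m].
    rewrite cat_uniq !map_inj_uniq ?iota_uniq //=; try by move=> i j [].
    by rewrite andbT; apply/hasPn => _ /mapP[k _ ->]; apply/mapP => -[].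
  exists (absz m).+1 => // N /= mN; rewrite mem_cat; apply/orP.
  case: m mN => k kN; [left|right]; apply/mapP; exists k => //.
    by rewrite mem_iota; move: kN => /=; lia.
  by rewrite mem_iota; move: kN => /=; lia.
apply: (exhausts_abs_summable (M := M1 + M2) Dex) => N.
by rewrite big_cat !big_map lerD ?b1 ?b2 ?iota_uniq.
Qed.

(** From 1 + x <= exp x and the geometric series. *)
Lemma prod1D_bound (c : R) N : 0 <= c ->
  \prod_(1 <= m < N.+1) (1 + c * rho ^+ m) <= expR (c / (1 - rho)).
Proof.
move=> c0; have r0 := ltW rho_gt0; have r1 : 0 < 1 - rho by rewrite subr_gt0.
apply: (@le_trans _ _ (expR (c * \sum_(1 <= m < N.+1) rho ^+ m))).
  elim: N => [|N IH]; first by rewrite !big_nil mulr0 expR0.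
  rewrite big_nat_recr //= [\sum_(1 <= m < N.+2) _]big_nat_recr //=.
  rewrite [c * (_ + _)]mulrDr expRD ler_pM ?expR_ge1Dx //.
    by apply: prodr_ge0 => m _; rewrite addr_ge0 ?mulr_ge0 ?exprn_ge0.
  by rewrite addr_ge0 ?mulr_ge0 ?exprn_ge0.
rewrite ler_expR ler_wpM2l // -[_^-1]mul1r ler_pdivlMr //.
have -> : (\sum_(1 <= m < N.+1) rho ^+ m) * (1 - rho) = rho - rho ^+ N.+1.
  elim: N => [|N IH]; first by rewrite big_nil mul0r subrr.
  by rewrite big_nat_recr //= mulrDl IH [in RHS]exprSr; ring.
by have := exprn_ge0 N.+1 r0; lra.
Qed.

(** For m >= 1, |1 - q^m| lies between 1 - rho^m and 1 + rho^m, and the inverse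
    of 1 - rho^m is at most 1 + c rho^m with c = 1 / (1 - rho); so both bounds
    come from prod1D_bound. *)
Lemma qfact_bounds : exists2 K : R, 0 < K &
  forall N, cabs (qfact q N) <= K /\ cabs (qfact q N)^-1 <= K.
Proof.
have r0 := ltW rho_gt0; have r1 : 0 < 1 - rho by rewrite subr_gt0.
pose c := (1 - rho)^-1; have c1 : 1 <= c by rewrite /c invf_ge1 //; lra.
exists (expR (c / (1 - rho))) => [|N]; first exact: expR_gt0.
have cN := prod1D_bound N (le_trans ler01 c1).
have low (m : nat) : 1 - rho ^+ m <= cabs (1 - q ^+ m) <= 1 + rho ^+ m.
  have := cabsD (1 - q ^+ m) (q ^+ m); rewrite subrK cabs1 cabsX -/rho.
  have := cabsD 1 (- q ^+ m); rewrite cabsN cabs1 cabsX -/rho; lra.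
split; apply: le_trans cN.
  rewrite /qfact cabs_prod big_nat_cond [leRHS]big_nat_cond.
  apply: ler_prod => m /andP[/andP[m0 _] _].
  rewrite cabs_ge0 /=; have /andP[_ le2] := low m.
  apply: le_trans le2 _; rewrite lerD2l; apply: ler_peMl => //; exact: exprn_ge0.
rewrite /qfact -prodfV cabs_prod big_nat_cond [leRHS]big_nat_cond.
apply: ler_prod => m /andP[/andP[m0 _] _].
rewrite cabs_ge0 cabsV /=; have /andP[le1 _] := low m.
have rm : rho ^+ m <= rho by rewrite -[leRHS]expr1 ler_wiXn2l //; lra.
have rm0 := exprn_ge0 m r0.
have p1 : 0 < 1 - rho ^+ m by lra.
have p2 : 0 < cabs (1 - q ^+ m) by apply: lt_le_trans le1.
rewrite -[_^-1]mul1r ler_pdivrMr //.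
apply: (@le_trans _ _ ((1 + c * rho ^+ m) * (1 - rho ^+ m))); last first.
  by rewrite ler_wpM2l // addr_ge0 // mulr_ge0 //; lra.
have : rho ^+ m <= c * rho ^+ m * (1 - rho ^+ m); last by lra.
rewrite mulrAC ler_peMl // /c mulrC ler_pdivlMr //; lra.
Qed.

Lemma qfact_neq0 N : qfact q N != 0.
Proof.
rewrite prodf_seq_neq0; apply/allP => m; rewrite mem_index_iota => /andP[m0 _] /=.
rewrite subr_eq0; apply/eqP => e.
by have := expr_lt1 m0 (cabs_ge0 q); rewrite -cabsX -e cabs1 ltxx q_lt1.
Qed.

(** The steps -q^(N+1) (q)_N are dominated by a geometric progression. *)
Lemma qfact_cvg : qfact q N @[N --> \oo] --> qpoch q.
Proof.
have [K K0 bK] := qfact_bounds; suff: cvg (qfact q @ \oo) by [].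
apply: (@geometric_steps_cvg _ _ K rho (ltW K0)); first by rewrite (ltW rho_gt0).
move=> N; rewrite qfactS (_ : _ - _ = - (q ^+ N.+1 * qfact q N)); last by ring.
rewrite cabsN cabsM cabsX -/rho mulrC exprS.
apply: ler_pM; rewrite ?cabs_ge0 ?mulr_ge0 ?exprn_ge0 ?(ltW rho_gt0) //.
  exact: (bK N).1.
by rewrite ler_piMl ?exprn_ge0 ?(ltW rho_gt0) ?ltW.
Qed.

(** The limit is nonzero because the inverses of the partial products stay
    bounded. *)
Lemma qpoch_neq0 : qpoch q != 0.
Proof.
have [K K0 bK] := qfact_bounds; apply/eqP => q0; have := qfact_cvg; rewrite q0.
have Ki : 0 < K^-1 by rewrite invr_gt0.
move=> /cvg_cabsP /(_ _ Ki) [N _ /(_ N (leqnn N))] /=.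
have [_] := bK N; rewrite sub0r cabsN cabsV => h1 h2.
have p : 0 < cabs (qfact q N) by rewrite lt_neqAle cabs_ge0 andbT eq_sym cabs_eq0 qfact_neq0.
move: h1 h2; rewrite -[(cabs _)^-1]mul1r -[K^-1]mul1r ler_pdivrMr // ltr_pdivlMr //.
by rewrite mulrC => h1 h2; have := lt_le_trans h2 h1; rewrite ltxx.
Qed.

Lemma qbin_bound : exists K : R, forall M k, cabs (qbin q M k) <= K.
Proof.
have [K K0 bK] := qfact_bounds; exists (K * (K * K)) => M k.
have [kM|Mk] := leqP k M; last by rewrite qbin_small // cabs0 !mulr_ge0 ?ltW.
have -> : qbin q M k = qfact q M * ((qfact q k)^-1 * (qfact q (M - k))^-1).
  by rewrite -(qbin_qfact q kM); field; rewrite !qfact_neq0.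
have [b1 _] := bK M; have [_ b2] := bK k; have [_ b3] := bK (M - k)%N.
by rewrite !cabsM !ler_pM ?mulr_ge0 ?cabs_ge0.
Qed.

(** All three q-factorials in the coefficient have the same nonzero limit. *)
Lemma qbin_cvg l :
  qbin q (2 * N) (absz (l + N%:Z)) @[N --> \oo] --> (qpoch q)^-1.
Proof.
have sub (f : nat -> nat) : (forall A, \forall N \near \oo, (A <= f N)%N) ->
    qfact q (f N) @[N --> \oo] --> qpoch q.
  move=> fA; apply: (@cvg_comp _ _ _ f (qfact q) \oo \oo); last exact: qfact_cvg.
  move=> P [A _ AP].
  by apply: filterS (fA A) => N; exact: AP.
have c0 : qfact q (2 * N) @[N --> \oo] --> qpoch q.
  by apply: sub => A; exists A => // N /=; lia.
have c1 : qfact q (absz (l + N%:Z)) @[N --> \oo] --> qpoch q.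
  by apply: sub => A; exists (A + absz l)%N => // N /=; lia.
have c2 : qfact q (2 * N - absz (l + N%:Z)) @[N --> \oo] --> qpoch q.
  by apply: sub => A; exists (A + absz l)%N => // N /=; lia.
have c12 : qfact q (absz (l + N%:Z)) * qfact q (2 * N - absz (l + N%:Z)) @[N --> \oo] -->
    qpoch q * qpoch q by exact: cvgM c1 c2.
have lim : qfact q (2 * N) * (qfact q (absz (l + N%:Z)) * qfact q (2 * N - absz (l + N%:Z)))^-1
    @[N --> \oo] --> (qpoch q)^-1.
  have -> : (qpoch q)^-1 = qpoch q * (qpoch q * qpoch q)^-1.
    by rewrite invfM mulrA mulfV ?mul1r ?qpoch_neq0.
  have nz : qpoch q * qpoch q != 0 by rewrite mulf_neq0 ?qpoch_neq0.
  exact: (cvgM c0 (cvgV nz c12)).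
apply: cvg_trans lim; apply: near_eq_cvg; exists (absz l) => // N /= lN.
rewrite -(@qbin_qfact _ q (2 * N) (absz (l + N%:Z))); last by lia.
by rewrite mulfK // mulf_neq0 ?qfact_neq0.
Qed.

(** The Jacobi triple product, obtained from its finite form by dominated
    convergence. The factors of finite_jacobi are shifted by one with respect to
    those of theta; the discrepancy is the factor 1 - x^-1 in the limit, which
    vanishes at x = 1, where both sides are 0. *)
Lemma jacobi_triple_product (s : CC R) : s != 0 ->
  summability.sum (jterm (s ^+ 2)) =
  qpoch q * s^-1 * ((s - s^-1) *
    lim ((fun N : nat => \prod_(1 <= m < N.+1)
          ((1 - q ^+ m * s ^+ 2) * (1 - q ^+ m * (s ^+ 2)^-1))) @ \oo)).
Proof.
move=> s0; set x := s ^+ 2; have x0 : x != 0 by rewrite expf_neq0.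
set A := (fun N : nat => _).
pose L N := \prod_(0 <= m < N) ((1 - q ^+ m.+1 * x) * (1 - q ^+ m * x^-1)).
have Llim : L N @[N --> \oo] --> (qpoch q)^-1 * summability.sum (jterm x).
  have [K bK] := qbin_bound.
  apply: eq_cvg_to (tannery (jterm_abs_summable x0) exhausts_window
    (fun N l => bK (2 * N)%N (absz (l + N%:Z))) qbin_cvg) => N.
  exact: finite_jacobi.
have Llim' : L N * (1 - q ^+ N * x^-1) @[N --> \oo] --> (qpoch q)^-1 * summability.sum (jterm x).
  rewrite -[X in _ --> X]mulr1; apply: cvgM Llim _.
  rewrite -[X in _ --> X]subr0 -(mul0r x^-1); apply: cvgB; first exact: cvg_cst.
  by apply: cvgM powers_cvg0 _; exact: cvg_cst.
have LA N : L N * (1 - q ^+ N * x^-1) = (1 - x^-1) * A N.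
  rewrite /L /A big_add1 /= big_split /= [in RHS]big_split /= -mulrA.
  rewrite [RHS]mulrCA; congr (_ * _).
  pose f (m : nat) := 1 - q ^+ m * x^-1.
  transitivity (\prod_(0 <= m < N.+1) f m); first by rewrite big_nat_recr.
  by rewrite big_nat_recl // {1}/f expr0 mul1r.
have hd : hausdorff_space (CC R) by exact: norm_hausdorff.
have [x1|x1] := eqVneq x 1.
  have s1 : s - s^-1 = 0.
    apply: (mulfI s0); rewrite mulr0 mulrBr mulfV // -expr2 -/x x1; exact: subrr.
  rewrite s1 mul0r mulr0; apply: (mulfI (x := (qpoch q)^-1)).
    by rewrite invr_neq0 ?qpoch_neq0.
  rewrite mulr0; apply: (cvg_unique hd Llim').
  apply: eq_cvg_to (cvg_cst (0 : CC R)) => N; by rewrite LA x1 invr1 subrr mul0r.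
have x1' : 1 - x^-1 != 0 by rewrite subr_eq0 eq_sym invr_eq1.
have Alim : A N @[N --> \oo] --> (1 - x^-1)^-1 * ((qpoch q)^-1 * summability.sum (jterm x)).
  apply: (eq_cvg_to (g := fun N => (1 - x^-1)^-1 * (L N * (1 - q ^+ N * x^-1)))).
    by move=> N; rewrite LA mulKf.
  by apply: cvgM Llim'; exact: cvg_cst.
rewrite (cvg_lim hd Alim).
have -> : s - s^-1 = s * (1 - x^-1) by rewrite /x; field.
move: (summability.sum _) => S; move: x1'; set y := 1 - _ => y0.
by field; rewrite y0 qpoch_neq0 s0.
Qed.

End JacobiTripleProduct.

(** * Series over Z^n *)

Section LatticeSums.
Variables (R : realType) (n : nat).

(** Indexed by finite functions, over which a product of sums expands. *)
Definition box (N : nat) : seq 'rV[int]_n :=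
  [seq (\row_i ((f i : nat)%:Z - N%:Z) : 'rV[int]_n)
     | f : {ffun 'I_n -> 'I_(2 * N).+1} <- enum {: {ffun 'I_n -> 'I_(2 * N).+1}}].

Lemma exhausts_box : exhausts box.
Proof.
split=> [N|x].
  rewrite map_inj_uniq ?enum_uniq // => f g /rowP fg; apply/ffunP => i.
  by have := fg i; rewrite !mxE => e; apply/val_inj => /=; lia.
exists (\sum_i absz (x ord0 i))%N => // N /= hN.
have le i : (absz (x ord0 i) <= N)%N by apply: leq_trans hN; rewrite (bigD1 i) //= leq_addr.
apply/mapP; exists [ffun i => inord (absz (x ord0 i + N%:Z))]; first by rewrite mem_enum.
apply/rowP => i; rewrite mxE ffunE; have := le i; move: (x ord0 i) => m mN.
by rewrite inordK; lia.
Qed.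

Lemma sum_box (S : comNzSemiRingType) (t : 'I_n -> int -> S) N :
  \sum_(x <- box N) \prod_i t i (x ord0 i) = \prod_i \sum_(l <- window N) t i l.
Proof.
rewrite big_map big_enum /=.
have window_ord (u : int -> S) :
    \sum_(l <- window N) u l = \sum_(j < (2 * N).+1) u ((j : nat)%:Z - N%:Z).
  by rewrite big_map -(big_mkord xpredT (fun k : nat => u (k%:Z - N%:Z))) /index_iota subn0.
under [RHS]eq_bigr => i _ do rewrite window_ord.
rewrite bigA_distr_bigA /=; apply: eq_bigr => f _; apply: eq_bigr => i _.
by rewrite mxE.
Qed.

(** Over a cube the sum of products is a product of sums, by distributivity. *)
Lemma lattice_product (t : 'I_n -> int -> CC R) :
  (forall i, abs_summable (t i)) ->
  abs_summable (fun x : 'rV[int]_n => \prod_i t i (x ord0 i)) /\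
  summability.sum (fun x : 'rV[int]_n => \prod_i t i (x ord0 i)) =
    \prod_i summability.sum (t i).
Proof.
move=> tS; have [M tM] := fin_all_exists tS.
have pS : abs_summable (fun x : 'rV[int]_n => \prod_i t i (x ord0 i)).
  apply: (exhausts_abs_summable (M := \prod_i M i) exhausts_box) => N.
  under [leLHS]eq_bigr => x _ do rewrite cabs_prod.
  rewrite (sum_box (fun i l => cabs (t i l))); apply: ler_prod => i _.
  apply/andP; split; first by apply: sumr_ge0 => l _; exact: cabs_ge0.
  apply: tM; exact: exhausts_window.1.
split=> //; apply: (cvg_unique _ (sum_exhaust pS exhausts_box)); first exact: norm_hausdorff.
apply: (eq_cvg_to (g := fun N => \prod_i \sum_(l <- window N) t i l)).
  by move=> N; rewrite sum_box.
apply: cvg_big => [|i _]; first exact: mul_continuous.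
exact: sum_exhaust (tS i) exhausts_window.
Qed.

(** Both sides are limits of the same partial sums: a sum over an exhaustion of
    the lattice by sums of boxes in the two sublattices. As the factors at 0 do
    not vanish, f l and g l are nonzero multiples of subfamilies of h, which
    makes them summable. *)
Lemma sum_lattice_split (d r : nat) (A : 'M[int]_(n, d)) (B : 'M[int]_(n, r))
    (h : 'rV[int]_n -> CC R) (L : seq 'rV[int]_n)
    (c : 'rV[int]_n -> CC R) (f g : 'rV[int]_n -> 'rV[int]_n -> CC R) :
  abs_summable h -> uniq L ->
  (forall x, exists l a b, [/\ l \in L, a *m B = 0, b *m A = 0 & x = l + a + b]) ->
  (forall l l' a a' b b', l \in L -> l' \in L -> a *m B = 0 -> a' *m B = 0 ->
     b *m A = 0 -> b' *m A = 0 -> l + a + b = l' + a' + b' ->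
     [/\ l = l', a = a' & b = b']) ->
  (forall l a b, l \in L -> a *m B = 0 -> b *m A = 0 ->
     h (l + a + b) = c l * f l a * g l b) ->
  (forall l, l \in L -> [/\ c l != 0, f l 0 != 0 & g l 0 != 0]) ->
  summability.sum h = \sum_(l <- L) c l * sum_ker B (f l) * sum_ker A (g l).
Proof.
move=> hS uL dec inj hE nz.
pose F (l x : 'rV[int]_n) : CC R := if x *m B == 0 then f l x else 0.
pose G (l x : 'rV[int]_n) : CC R := if x *m A == 0 then g l x else 0.
have FS l : l \in L -> abs_summable (F l).
  move=> lL; have [c0 f0 g0] := nz l lL.
  have k0 : 0 <= (cabs (c l * g l 0))^-1 by rewrite invr_ge0 cabs_ge0.
  apply: (abs_summable_comp (@addrI _ l) k0 _ hS) => x; rewrite /F; case: eqP => [xB|_]; last first.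
    by rewrite cabs0 mulr_ge0 ?invr_ge0 ?cabs_ge0.
  have := hE l x 0 lL xB (mul0mx _ _); rewrite addr0 => ->; rewrite -cabsV -cabsM.
  by rewrite le_eqVlt (_ : _ * _ = f l x) ?eqxx //; field; rewrite c0 g0.
have GS l : l \in L -> abs_summable (G l).
  move=> lL; have [c0 f0 g0] := nz l lL.
  have k0 : 0 <= (cabs (c l * f l 0))^-1 by rewrite invr_ge0 cabs_ge0.
  apply: (abs_summable_comp (@addrI _ l) k0 _ hS) => x; rewrite /G; case: eqP => [xA|_]; last first.
    by rewrite cabs0 mulr_ge0 ?invr_ge0 ?cabs_ge0.
  have := hE l 0 x lL (mul0mx _ _) xA; rewrite addr0 => ->; rewrite -cabsV -cabsM.
  by rewrite le_eqVlt (_ : _ * _ = g l x) ?eqxx //; field; rewrite c0 f0.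
pose T N := [seq (l, ab) | l <- L, ab <- [seq (a, b)
   | a <- [seq a <- box N | a *m B == 0], b <- [seq b <- box N | b *m A == 0]]].
pose phi (x : 'rV[int]_n * ('rV[int]_n * 'rV[int]_n)) := x.1 + x.2.1 + x.2.2.
have inT N x : x \in T N = [&& x.1 \in L, x.2.1 *m B == 0, x.2.2 *m A == 0,
    x.2.1 \in box N & x.2.2 \in box N].
  apply/allpairsPdep/and5P => [[l [ab [lL]]]|[lL aB bA aN bN]].
    move=> /allpairsPdep[a [b [+ + ->]]] ->; rewrite !mem_filter /=.
    by move=> /andP[aB aN] /andP[bA bN].
  exists x.1, x.2; split; [by []| |by case: x {lL aB bA aN bN}].
  apply/allpairsPdep; exists x.2.1, x.2.2; rewrite !mem_filter; split.
  - by rewrite aB.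
  - by rewrite bA.
  - by case: x.2.
have Dex : exhausts (fun N => map phi (T N)).
  split=> [N|x].
    rewrite map_inj_in_uniq.
      rewrite !allpairs_uniq ?filter_uniq //; try exact: exhausts_box.1; by move=> [? ?] [? ?] _ _.
    move=> [l [a b]] [l' [a' b']]; rewrite !inT /= => /and5P[lL /eqP aB /eqP bA _ _].
    move=> /and5P[lL' /eqP aB' /eqP bA' _ _] e.
    by have [-> -> ->] := inj _ _ _ _ _ _ lL lL' aB aB' bA bA' e.
  have [l [a [b [lL aB bA ->]]]] := dec x.
  apply: filterS (filterI (exhausts_box.2 a) (exhausts_box.2 b)) => N [aN bN].
  apply/mapP; exists (l, (a, b)) => //; by rewrite inT /= lL aB bA !eqxx aN bN.
apply: (cvg_unique _ (sum_exhaust hS Dex)); first exact: norm_hausdorff.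
apply: (eq_cvg_to (g := fun N => \sum_(l <- L)
    c l * (\sum_(x <- box N) F l x) * (\sum_(x <- box N) G l x))).
  move=> N; rewrite big_map big_allpairs /=; apply: eq_big_seq => l lL.
  rewrite big_allpairs /= !big_filter -!big_mkcond /= -mulrA mulr_suml mulr_sumr.
  apply: eq_bigr => a /eqP aB; rewrite mulr_sumr mulr_sumr big_filter.
  by apply: eq_bigr => b /eqP bA; rewrite hE //= mulrA.
rewrite big_seq; under eq_fun => N do rewrite big_seq.
apply: cvg_big => [|l lL]; first exact: add_continuous.
apply: cvgM; last exact: sum_exhaust (GS l lL) exhausts_box.
apply: cvgM; first exact: cvg_cst.
exact: sum_exhaust (FS l lL) exhausts_box.
Qed.

End LatticeSums.

(** * The standard inner product of Z^n *)

Section DotProduct.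
Variable n : nat.
Implicit Types x y : 'rV[int]_n.

Lemma dotE x y : dot x y = \sum_i x ord0 i * y ord0 i.
Proof. by rewrite /dot mxE; apply: eq_bigr => i _; rewrite mxE. Qed.

Lemma dotDl x y z : dot (x + y) z = dot x z + dot y z.
Proof. by rewrite /dot mulmxDl mxE. Qed.

Lemma dotDr x y z : dot z (x + y) = dot z x + dot z y.
Proof. by rewrite /dot linearD mulmxDr mxE. Qed.

Lemma dotNl x y : dot (- x) y = - dot x y.
Proof. by rewrite /dot mulNmx mxE. Qed.

Lemma dotZl (t : int) x y : dot (t *: x) y = t * dot x y.
Proof. by rewrite /dot -scalemxAl mxE. Qed.

Lemma dotC x y : dot x y = dot y x.
Proof. by rewrite !dotE; apply: eq_bigr => i _; rewrite mulrC. Qed.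

Lemma dotNr x y : dot x (- y) = - dot x y.
Proof. by rewrite dotC dotNl dotC. Qed.

Lemma dot0l x : dot 0 x = 0.
Proof. by rewrite /dot mul0mx mxE. Qed.

Lemma dot0r x : dot x 0 = 0.
Proof. by rewrite dotC dot0l. Qed.

Lemma dot_suml (T : Type) (s : seq T) (P : pred T) (F : T -> 'rV[int]_n) y :
  dot (\sum_(k <- s | P k) F k) y = \sum_(k <- s | P k) dot (F k) y.
Proof. by rewrite /dot mulmx_suml summxE. Qed.

Lemma epsE (i k : 'I_n) : eps i ord0 k = (k == i)%:R :> int.
Proof. by rewrite /eps mxE. Qed.

Lemma sum_eps (D : {set 'I_n}) (f : 'I_n -> int) k :
  (\sum_(j in D) f j *: eps j) ord0 k = if k \in D then f k else 0.
Proof.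
rewrite summxE; have [kD|kD] := ifPn; last first.
  apply: big1 => j jD; rewrite mxE epsE.
  by case: eqP => [kj|_]; rewrite ?mulr0 //; rewrite kj jD in kD.
rewrite (bigD1 k) //= mxE epsE eqxx mulr1 big1 ?addr0 // => j /andP[_ jk].
by rewrite mxE epsE eq_sym (negPf jk) mulr0.
Qed.

Lemma dot_eps i x : dot (eps i) x = x ord0 i.
Proof.
rewrite dotE (bigD1 i) //= epsE eqxx mul1r big1 ?addr0 // => k /negPf ki.
by rewrite epsE ki mul0r.
Qed.

Lemma dot_eq0 x : dot x x = 0 -> x = 0.
Proof.
move=> /eqP; rewrite dotE psumr_eq0 => [/allP h|k _]; last by rewrite -expr2 sqr_ge0.
apply/rowP => k; rewrite mxE; apply/eqP.
by have := h k (mem_index_enum _); rewrite /= mulf_eq0 orbb.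
Qed.

Lemma entryB x y i : (x - y) ord0 i = x ord0 i - y ord0 i.
Proof. by rewrite !mxE. Qed.

Lemma rV_eps x : x = \sum_i x ord0 i *: eps i.
Proof. exact: row_sum_delta. Qed.

Lemma dot_two i j x y : i != j ->
  (forall k, k != i -> k != j -> x ord0 k * y ord0 k = 0) ->
  dot x y = x ord0 i * y ord0 i + x ord0 j * y ord0 j.
Proof.
move=> ij xy; rewrite dotE (bigD1 i) //= (bigD1 j) 1?eq_sym //= big1 ?addr0 //.
by move=> k /andP[ki kj]; exact: xy.
Qed.

Lemma supportedD (I : {set 'I_n}) x y : supported I x -> supported I y -> supported I (x + y).
Proof. by move=> hx hy k kI; rewrite mxE hx ?hy. Qed.

Lemma supportedZ (I : {set 'I_n}) (t : int) x : supported I x -> supported I (t *: x).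
Proof. by move=> hx k kI; rewrite mxE hx ?mulr0. Qed.

End DotProduct.

(** * Signed circuits *)

Section Circuits.
Local Open Scope set_scope.
Variables n k : nat.
Implicit Types (M : 'M[int]_(n, k)) (C : {set 'I_n} * {set 'I_n}) (v : 'rV[int]_n).

Lemma circuit_vecE C i :
  circuit_vec C ord0 i = (i \in C.1)%:R - (i \in C.2)%:R.
Proof.
have sumE (D : {set 'I_n}) : (\sum_(j in D) eps j) ord0 i = (i \in D)%:R :> int.
  under eq_bigr => j _ do rewrite -[eps j]scale1r.
  by rewrite sum_eps; case: ifP.
by rewrite /circuit_vec !mxE !sumE.
Qed.

Lemma circuit_vec_ker M C : signed_circuit M C -> circuit_vec C *m M = 0.
Proof.
move=> [_ _ _ e]; rewrite /circuit_vec mulmxBl !mulmx_suml.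
rewrite (eq_bigr (fun i => row i M)) => [|i _]; last by rewrite -rowE.
by rewrite [X in _ - X](eq_bigr (fun i => row i M)) ?e ?subrr // => i _; rewrite -rowE.
Qed.

(** Minimality of the support of v: a kernel vector on a proper part of it is a
    multiple of v with a zero coordinate on the support of v, hence 0. *)
Lemma sign_vector_circuit M v i0 :
  v *m M = 0 -> v ord0 i0 = 1 ->
  (forall i, v ord0 i = 0 \/ v ord0 i = 1 \/ v ord0 i = -1) ->
  (forall c, supported [set i | v ord0 i != 0] c -> c *m M = 0 -> exists t : int, c = t *: v) ->
  signed_circuit M ([set i | v ord0 i == 1], [set i | v ord0 i == -1]).
Proof.
move=> vM v1 vs vmin.
have supp : [set i | v ord0 i == 1] :|: [set i | v ord0 i == -1] = [set i | v ord0 i != 0].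
  apply/setP => i; rewrite !inE; by case: (vs i) => [|[]] ->.
split => /=.
- apply/setP => i; rewrite !inE; by case: (vs i) => [|[]] ->.
- rewrite supp => /(_ v) hv; have : v = 0.
    by apply: hv vM => i; rewrite inE negbK => /eqP.
  by move=> v0; move: v1; rewrite v0 mxE.
- move=> D; rewrite supp => /properP[DS [j jS jD]] c cD cM.
  have [|t ct] := vmin c _ cM.
    by move=> i iS; apply: cD; apply: contraNN iS => iD; exact: (fintype.subsetP DS _ iD).
  have : c ord0 j = 0 by exact: cD.
  rewrite ct mxE => /eqP; rewrite mulf_eq0; move: jS; rewrite inE => /negPf ->.
  by rewrite orbF => /eqP ->; rewrite scale0r.
- apply/eqP; rewrite -subr_eq0; apply/eqP; rewrite -[RHS]vM {3}(rV_eps v) mulmx_suml.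
  rewrite [in LHS](big_mkcond (mem [set i | v ord0 i == 1])) /=.
  rewrite [X in _ - X = _](big_mkcond (mem [set i | v ord0 i == -1])) /= -sumrB.
  apply: eq_bigr => i _; rewrite -scalemxAl -rowE !inE.
  by case: (vs i) => [|[]] -> /=; rewrite ?scale0r ?scale1r ?scaleN1r ?subr0 ?sub0r.
Qed.

Lemma fund_vecP M (I : {set 'I_n}) j C0 :
  signed_circuit M C0 -> C0.1 :|: C0.2 \subset j |: I -> j \in C0.1 ->
  [/\ exists2 C, signed_circuit M C & fund_vec M I j = circuit_vec C,
      fund_vec M I j *m M = 0,
      fund_vec M I j ord0 j = 1 &
      forall i, i \notin j |: I -> fund_vec M I j ord0 i = 0].
Proof.
move=> cC0 sC0 jC0; pose S := [set C | [/\ signed_circuit M C,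
  C.1 :|: C.2 \subset j |: I & j \in C.1]]%classic.
rewrite /fund_vec -/S.
have : S (xget (finset.set0, finset.set0) S) by apply: (xgetPex _ (ex_intro _ C0 _)).
move: (xget _ _) => C [cC sC jC].
split; [by exists C|exact: circuit_vec_ker| |].
  rewrite circuit_vecE jC; case: cC => /setP /(_ j); rewrite !inE jC /= => -> _ _ _.
  by rewrite subr0.
move=> i; rewrite circuit_vecE => /(contra (fintype.subsetP sC i)).
by rewrite inE negb_or => /andP[/negPf -> /negPf ->]; rewrite subr0.
Qed.

Lemma circuit_vec_sign C i :
  circuit_vec C ord0 i = 0 \/ circuit_vec C ord0 i = 1 \/ circuit_vec C ord0 i = -1.
Proof. rewrite circuit_vecE; case: (i \in C.1); case: (i \in C.2) => /=; lia. Qed.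

End Circuits.

(** * Fundamental circuits and cocircuits of a basis *)

Section BasisCardinal.
Local Open Scope set_scope.
Variables n k : nat.
Variable M : 'M[int]_(n, k).

(** Coordinates in a basis form a two-sided inverse of its matrix, which is
    therefore square. *)
Lemma basis_card (I : {set 'I_n}) : is_basis M I -> #|I| = k.
Proof.
move=> [ind gen].
pose MI : 'M[int]_(#|I|, k) := \matrix_(a, j) M (enum_val a) j.
pose ext (c : 'rV[int]_#|I|) : 'rV[int]_n := \sum_a c ord0 a *: eps (enum_val a).
have extM c : ext c *m M = c *m MI.
  rewrite /ext mulmx_suml; apply/rowP => j; rewrite summxE mxE.
  by apply: eq_bigr => a _; rewrite -scalemxAl -rowE !mxE.
have extE c a : ext c ord0 (enum_val a) = c ord0 a.
  rewrite /ext summxE (bigD1 a) //= mxE epsE eqxx mulr1 big1 ?addr0 // => b ba.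
  by rewrite mxE epsE (inj_eq enum_val_inj) eq_sym (negPf ba) mulr0.
have extS c : supported I (ext c).
  move=> i iI; rewrite /ext summxE big1 // => a _; rewrite mxE epsE.
  by case: eqP => [ia|_]; rewrite ?mulr0 //; move: iI; rewrite ia enum_valP.
have resP c : supported I c -> c = ext (\row_a c ord0 (enum_val a)).
  move=> cI; apply/rowP => i; have [iI|iI] := boolP (i \in I); last by rewrite cI ?extS.
  by rewrite -(enum_rankK_in iI iI) extE mxE.
have freeMI (c : 'rV[int]_#|I|) : c *m MI = 0 -> c = 0.
  rewrite -extM => /(ind _ (extS c)) c0; apply/rowP => a.
  by rewrite -extE c0 !mxE.
have fullMI (h : 'rV[int]_k) : exists c, c *m MI = h.
  by have [c /resP -> <-] := gen h; exists (\row_a c ord0 (enum_val a)); rewrite extM.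
have [N NP] := fin_all_exists (fun j => fullMI (row j 1%:M)).
pose P : 'M[int]_(k, #|I|) := \matrix_j N j.
have PM : P *m MI = 1%:M.
  by apply/row_matrixP => j; rewrite row_mul rowK NP.
have MP : MI *m P = 1%:M.
  apply/row_matrixP => a; apply/eqP; rewrite -subr_eq0; apply/eqP/freeMI.
  by rewrite mulmxBl -row_mul -mulmxA PM mulmx1 -row_mul mul1mx subrr.
by apply/eqP; rewrite eqn_leq (mulmx1_min MP) (mulmx1_min PM).
Qed.

End BasisCardinal.

Section FundamentalVectors.
Local Open Scope set_scope.
Variables n d r : nat.
Variable X : hk_data n d r.
Hypothesis toricX : toric_hk X.
Let A := amx X.
Let B := bmx X.

Lemma kerA_imB b : b *m A = 0 -> exists y : 'rV[int]_r, b = y *m B^T.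
Proof. by have [_ /(_ b)[]] := hk_exact toricX. Qed.

Lemma kerB_kerA_orthogonal a b : a *m B = 0 -> b *m A = 0 -> dot a b = 0.
Proof.
move=> aB /kerA_imB[y ->].
by rewrite /dot trmx_mul trmxK mulmxA aB mul0mx mxE.
Qed.

(** The inner product is positive definite. *)
Lemma kerB_kerA_disjoint (x : 'rV[int]_n) : x *m B = 0 -> x *m A = 0 -> x = 0.
Proof. by move=> xB xA; apply: dot_eq0; exact: kerB_kerA_orthogonal. Qed.

(** The vector x *m B *m B^T lies in Ker A, and its inner product with x is the
    square norm of x *m B. *)
Lemma orthogonal_kerA_kerB (x : 'rV[int]_n) :
  (forall b, b *m A = 0 -> dot x b = 0) -> x *m B = 0.
Proof.
move=> xA; apply: dot_eq0; rewrite -(xA (x *m B *m B^T)).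
  by rewrite /dot !trmx_mul trmxK !mulmxA.
by have [_ /(_ (x *m B *m B^T))[_ h] _] := hk_exact toricX; apply: h; exists (x *m B).
Qed.

Variable I : {set 'I_n}.
Hypothesis basI : is_basis A I.

Lemma kerA_supported_eq0 c : supported I c -> c *m A = 0 -> c = 0.
Proof. exact: basI.1. Qed.

(** Exchange: if a_i occurs in the expansion of a_j, it can be replaced by a_j,
    so its coefficient is a unit by unimodularity. *)
Lemma coordinate_sign j c : j \notin I -> supported I c -> c *m A = row j A ->
  forall i, c ord0 i = 0 \/ c ord0 i = 1 \/ c ord0 i = -1.
Proof.
move=> jI cI cA i; have [iI|iI] := boolP (i \in I); last by left; exact: cI.
have [->|ci0] := eqVneq (c ord0 i) 0; [by left|right].
pose I' := j |: (I :\ i).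
have cardI' : #|I'| = d.
  rewrite cardsU1 !inE negb_and jI orbT /= -(basis_card basI) [in RHS](cardsD1 i) iI.
  by [].
have split_I' e : supported I' e ->
    exists2 e', supported I e' & e' ord0 i = 0 /\ e = e ord0 j *: eps j + e'.
  move=> eI'; exists (e - e ord0 j *: eps j); last first.
    split; last by rewrite addrC subrK.
    rewrite !mxE /=; have ij : i != j by apply: contraNneq jI => <-.
    by rewrite ?eqxx (negPf ij) mulr0 subr0 eI' // !inE eqxx (negPf ij).
  move=> k kI; rewrite !mxE /=; have [->|kj] := eqVneq k j; first by rewrite ?eqxx mulr1 subrr.
  by rewrite ?eqxx mulr0 subr0 eI' // !inE negb_or kj negb_and kI orbT.
have val e' t : supported I e' -> supported I (t *: c + e').
  by move=> hI; apply: supportedD => //; exact: supportedZ.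
have epsA : eps j *m A = c *m A by rewrite cA -rowE.
have indI' : lin_indep A I'.
  move=> e /split_I'[e' e'I [e'i ee]] eA.
  have : e ord0 j *: c + e' = 0.
    apply: kerA_supported_eq0; first exact: val.
    by rewrite mulmxDl -scalemxAl -epsA scalemxAl -mulmxDl -ee.
  move=> z; have := congr1 (fun v : 'rV_n => v ord0 i) z.
  rewrite !mxE e'i addr0 => /eqP; rewrite mulf_eq0 (negPf ci0) orbF => /eqP ej.
  by move: z; rewrite ej scale0r add0r => e'0; rewrite ee ej e'0 scale0r addr0.
have [e /split_I'[e' e'I [e'i ee]] eA] := hk_unimodular toricX cardI' indI' (row i A).
have : eps i = e ord0 j *: c + e'.
  apply/eqP; rewrite eq_sym -subr_eq0; apply/eqP; apply: kerA_supported_eq0.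
    apply: supportedD; first exact: val.
    move=> k kI; rewrite mxE epsE (_ : k == i = false) ?oppr0 //.
    by apply/negP => /eqP ki; rewrite ki iI in kI.
  rewrite mulmxBl mulmxDl -scalemxAl -epsA scalemxAl -mulmxDl -ee eA.
  by rewrite -rowE subrr.
move=> /(congr1 (fun v : 'rV_n => v ord0 i)); rewrite epsE eqxx !mxE e'i addr0.
move: (c ord0 i) (e ord0 j) => u v uv.
have : (`|u| %| 1)%N by rewrite -(dvdzE u 1); apply/dvdzP; exists v.
by rewrite dvdn1; lia.
Qed.

(** The relation expressing a_j in the basis I. *)
Lemma fund_kernel_vector j : j \notin I -> exists v : 'rV[int]_n,
  [/\ v *m A = 0, v ord0 j = 1, forall k, k \notin j |: I -> v ord0 k = 0
    & forall k, v ord0 k = 0 \/ v ord0 k = 1 \/ v ord0 k = -1].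
Proof.
move=> jI; have [c cI cA] := basI.2 (row j A); exists (eps j - c); split.
- by rewrite mulmxBl cA -rowE subrr.
- by rewrite entryB epsE eqxx cI ?subr0.
- move=> k; rewrite !inE negb_or => /andP[kj kI].
  by rewrite entryB epsE (negPf kj) cI ?subr0.
- move=> k; rewrite entryB epsE; have [->|kj] := eqVneq k j.
    by right; left; rewrite cI ?subr0.
  rewrite sub0r; case: (coordinate_sign jI cI cA k) => [->|[]->]; rewrite ?opprK ?oppr0; tauto.
Qed.

(** A kernel vector is determined by its coordinates outside the basis, as the
    difference of two with the same ones is a relation within the basis. *)
Lemma kernel_expansion (v : 'I_n -> 'rV[int]_n) x : x *m A = 0 ->
  (forall j, j \notin I -> [/\ v j *m A = 0, v j ord0 j = 1 &
     forall k, k \notin j |: I -> v j ord0 k = 0]) ->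
  x = \sum_(j in ~: I) x ord0 j *: v j.
Proof.
move=> xA vP; apply/eqP; rewrite -subr_eq0; apply/eqP; apply: kerA_supported_eq0.
  move=> k kI; rewrite entryB summxE (bigD1 k) ?inE //= mxE.
  have [_ -> _] := vP k kI; rewrite mulr1 big1 ?addr0 ?subrr // => j.
  rewrite inE => /andP[jI jk]; have [_ _ vI] := vP j jI.
  by rewrite mxE vI ?mulr0 // !inE negb_or eq_sym jk.
rewrite mulmxBl xA mulmx_suml big1 ?subrr // => j; rewrite inE => jI.
by rewrite -scalemxAl; have [-> _ _] := vP j jI; rewrite scaler0.
Qed.

(** The kernel vector of fund_kernel_vector is carried by a signed circuit; so
    the fundamental circuit exists and the genericity of eta applies to it. *)
Lemma beta_spec j : j \notin I ->
  [/\ beta X I j *m A = 0, beta X I j ord0 j = 1,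
      forall k, k \notin I -> k != j -> beta X I j ord0 k = 0,
      forall k, beta X I j ord0 k = 0 \/ beta X I j ord0 k = 1 \/ beta X I j ord0 k = -1 &
      pairing B (eta X) (beta X I j) != 0].
Proof.
move=> jI; have [v [vA vj vI vs]] := fund_kernel_vector jI.
have cC := @sign_vector_circuit n d A v j vA vj vs.
have {}cC : signed_circuit A ([set i | v ord0 i == 1], [set i | v ord0 i == -1]).
  apply: cC => c cS cA; exists (c ord0 j).
  apply/eqP; rewrite -subr_eq0; apply/eqP; apply: kerA_supported_eq0; last first.
    by rewrite mulmxBl -scalemxAl vA scaler0 cA subrr.
  move=> k kI; rewrite !mxE; have [->|kj] := eqVneq k j; first by rewrite vj mulr1 subrr.
  have vk : v ord0 k = 0 by rewrite vI // !inE negb_or kj.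
  have ck : c ord0 k = 0 by apply: cS; rewrite inE vk eqxx.
  by rewrite ck vk mulr0 addr0.
have [||[C Cc fC] fA fj fI] := @fund_vecP n d A I j _ cC.
- apply/fintype.subsetP => k kC; apply: contraT => /vI vk.
  by move: kC; rewrite !inE vk.
- by rewrite inE vj.
split => //.
- by move=> k kI kj; rewrite fI // !inE negb_or kj.
- by move=> k; rewrite /beta fC; exact: circuit_vec_sign.
- by rewrite /beta fC; exact: (hk_eta_generic toricX).
Qed.

Lemma kerA_expansion x : x *m A = 0 -> x = \sum_(j in ~: I) x ord0 j *: beta X I j.
Proof.
move=> xA; apply: kernel_expansion => // j jI; have [bA bj bI _ _] := beta_spec jI.
by split=> // k; rewrite !inE negb_or => /andP[kj kI]; exact: bI.
Qed.

(** The transpose of the matrix of coordinates of the beta's, up to sign, gives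
    the vectors dual to the basis I. *)
Lemma dual_kernel_vector i : i \in I -> exists u : 'rV[int]_n,
  [/\ u *m B = 0, u ord0 i = 1, forall k, k \in I -> k != i -> u ord0 k = 0
    & forall j, j \notin I -> u ord0 j = - beta X I j ord0 i].
Proof.
move=> iI; exists (eps i - \sum_(j in ~: I) beta X I j ord0 i *: eps j).
split.
- apply: orthogonal_kerA_kerB => x /kerA_expansion xE.
  rewrite dotDl dotNl dot_eps dot_suml {1}xE summxE -sumrB big1 // => j _.
  by rewrite dotZl dot_eps mxE mulrC subrr.
- by rewrite entryB epsE eqxx sum_eps inE iI subr0.
- by move=> k kI ki; rewrite entryB epsE (negPf ki) sum_eps inE kI subr0.
- move=> j jI; rewrite entryB epsE sum_eps inE jI (_ : j == i = false) ?sub0r //.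
  by apply/negP => /eqP ji; rewrite ji iI in jI.
Qed.

(** Dually, a vector of Ker B carried by the support of the dual vector is
    orthogonal to all beta_j, which makes it a multiple of the dual vector. *)
Lemma alpha_spec i : i \in I ->
  [/\ alpha X I i *m B = 0, alpha X I i ord0 i = 1,
      forall k, k \in I -> k != i -> alpha X I i ord0 k = 0 &
      pairing A (xi X) (alpha X I i) != 0].
Proof.
move=> iI; have [u [uB ui uI uI']] := dual_kernel_vector iI.
have us k : u ord0 k = 0 \/ u ord0 k = 1 \/ u ord0 k = -1.
  have [kI|kI] := boolP (k \in I); last first.
    by rewrite uI' //; have [_ _ _ /(_ i) bs _] := beta_spec kI; lia.
  by have [->|ki] := eqVneq k i; [right; left | left; exact: uI].
have cC := @sign_vector_circuit n r B u i uB ui us.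
have {}cC : signed_circuit B ([set k | u ord0 k == 1], [set k | u ord0 k == -1]).
  apply: cC => c cS cB; exists (c ord0 i); apply/rowP => k; rewrite mxE.
  have cI l : l \in I -> l != i -> c ord0 l = 0.
    by move=> lI li; apply: cS; rewrite inE uI ?eqxx.
  have [kI|kI] := boolP (k \in I).
    have [->|ki] := eqVneq k i; first by rewrite ui mulr1.
    by rewrite (uI k) // (cI k) // mulr0.
  have [bA bk bI _ _] := beta_spec kI.
  have ik : i != k by apply: contraNneq kI => <-.
  have := kerB_kerA_orthogonal cB bA; rewrite (dot_two ik) => [|l li lk].
    by rewrite bk mulr1 uI' // mulrN addrC => /eqP; rewrite addr_eq0 => /eqP.
  have [lI|lI] := boolP (l \in I); first by rewrite cI ?mul0r.
  by rewrite bI ?mulr0.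
have [||[C Cc fC] fB fi fI] := @fund_vecP n r B (~: I) i _ cC.
- apply/fintype.subsetP => k kC; apply: contraT; rewrite !inE negb_or negbK => /andP[ki kI].
  by move: kC; rewrite !inE uI.
- by rewrite inE ui.
split => //.
- by move=> k kI ki; rewrite /alpha fI // !inE negb_or ki negbK.
- by rewrite /alpha fC; exact: (hk_xi_generic toricX).
Qed.

(** alpha_i and beta_j are orthogonal and share only the indices i and j of
    their supports. *)
Lemma alpha_beta i j : i \in I -> j \notin I -> alpha X I i ord0 j = - beta X I j ord0 i.
Proof.
move=> iI jI; have [aB ai aI _] := alpha_spec iI; have [bA bj bI _ _] := beta_spec jI.
have ij : i != j by apply: contraNneq jI => <-.
have := kerB_kerA_orthogonal aB bA; rewrite (dot_two ij) => [|k ki kj].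
  by rewrite ai bj; lia.
have [kI|kI] := boolP (k \in I); first by rewrite aI ?mul0r.
by rewrite bI ?mulr0.
Qed.

(** The projections of Z^n along the coordinate sublattices of I^c and of I,
    which appear in the restrictions of L(lam) and L^!(lam), have images Ker B
    and Ker A. *)
Lemma kerB_projection lam :
  lam - \sum_(j in ~: I) dot lam (beta X I j) *: eps j =
  \sum_(i in I) lam ord0 i *: alpha X I i.
Proof.
apply/rowP => k; rewrite entryB sum_eps inE [RHS]summxE.
have [kI|kI] /= := boolP (k \in I).
  have [_ ak _ _] := alpha_spec kI.
  rewrite subr0 (bigD1 k) //= mxE ak mulr1 big1 ?addr0 // => i /andP[iI ik].
  by have [_ _ aI _] := alpha_spec iI; rewrite mxE aI ?mulr0 // eq_sym.
have [_ bk bI _ _] := beta_spec kI.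
rewrite dotE (bigID (mem I)) /= [X in _ - (_ + X)](bigD1 k) //= bk mulr1.
rewrite [X in _ - (_ + (_ + X))]big1 => [|l /andP[lI lk]]; last by rewrite bI ?mulr0.
rewrite addr0 opprD addrCA addrN addr0 -sumrN; apply: eq_bigr => i iI.
by rewrite [RHS]mxE alpha_beta // mulrN.
Qed.

Lemma kerA_projection lam :
  lam - \sum_(i in I) dot lam (alpha X I i) *: eps i =
  \sum_(j in ~: I) lam ord0 j *: beta X I j.
Proof.
apply/rowP => k; rewrite entryB sum_eps [RHS]summxE.
have [kI|kI] /= := boolP (k \in I); last first.
  have [_ bk _ _ _] := beta_spec kI.
  rewrite subr0 (bigD1 k) ?inE //= mxE bk mulr1 big1 ?addr0 // => j.
  rewrite inE => /andP[jI jk].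
  by have [_ _ bI _ _] := beta_spec jI; rewrite mxE bI ?mulr0 // eq_sym.
have [_ ak aI _] := alpha_spec kI.
rewrite dotE (bigID (mem I)) /= (bigD1 k) //= ak mulr1.
rewrite big1 => [|l /andP[lI lk]]; last by rewrite aI ?mulr0.
rewrite addr0 opprD addrA addrN add0r -sumrN; apply: eq_big => [j|j jI]; first by rewrite inE.
by rewrite [RHS]mxE alpha_beta // mulrN opprK.
Qed.

End FundamentalVectors.

(** * The quotient Xi *)

Section Lifts.
Variables n d r : nat.
Variable X : hk_data n d r.
Hypothesis toricX : toric_hk X.
Local Notation A := (amx X).
Local Notation B := (bmx X).

Lemma in_sum_lattice0 : in_sum_lattice X 0.
Proof. by exists 0, 0; rewrite !mul0mx addr0. Qed.

Lemma in_sum_latticeD x y :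
  in_sum_lattice X x -> in_sum_lattice X y -> in_sum_lattice X (x + y).
Proof.
move=> [a [b [aB bA ->]]] [a' [b' [aB' bA' ->]]]; exists (a + a'), (b + b').
by rewrite !mulmxDl aB aB' bA bA' !addr0 addrACA.
Qed.

Lemma in_sum_latticeZ (t : int) x : in_sum_lattice X x -> in_sum_lattice X (t *: x).
Proof.
move=> [a [b [aB bA ->]]]; exists (t *: a), (t *: b).
by rewrite -!scalemxAl aB bA !scaler0 scalerDr.
Qed.

Lemma in_sum_latticeN x : in_sum_lattice X x -> in_sum_lattice X (- x).
Proof. by rewrite -scaleN1r; exact: in_sum_latticeZ. Qed.

(** The alpha's and beta's attached to a basis form a square matrix, regular
    because the two sublattices are orthogonal; its determinant kills the
    quotient. *)
Lemma sum_lattice_exponent (I : {set 'I_n}) : is_basis A I ->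
  exists2 N : int, N != 0 & forall x, in_sum_lattice X (N *: x).
Proof.
move=> basI; pose g i := if i \in I then alpha X I i else beta X I i.
pose G : 'M[int]_n := \matrix_i g i.
have gL i : in_sum_lattice X (g i).
  rewrite /g; have [iI|iI] := ifPn.
    have [aB _ _ _] := alpha_spec toricX basI iI.
    by exists (alpha X I i), 0; rewrite mul0mx addr0.
  have [bA _ _ _ _] := beta_spec toricX basI iI.
  by exists 0, (beta X I i); rewrite mul0mx add0r.
have mulG v : v *m G = \sum_i v ord0 i *: g i.
  by rewrite mulmx_sum_row; apply: eq_bigr => i _; rewrite rowK.
exists (\det G) => [|x]; last first.
  rewrite -mul_mx_scalar -mul_adj_mx mulmxA mulG.
  elim/big_ind: _ => [|y z hy hz|i _]; first exact: in_sum_lattice0.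
    exact: in_sum_latticeD.
  exact: in_sum_latticeZ.
apply/negP => /det0P[v v0]; rewrite mulG (bigID (mem I)) /=.
set a := \sum_(i | i \in I) _; set b := \sum_(i | i \notin I) _ => ab.
have aB : a *m B = 0.
  rewrite mulmx_suml big1 // => i iI; rewrite -scalemxAl /g iI.
  by have [-> _ _ _] := alpha_spec toricX basI iI; rewrite scaler0.
have bA : b *m A = 0.
  rewrite mulmx_suml big1 // => i iI; rewrite -scalemxAl /g (negPf iI).
  by have [-> _ _ _ _] := beta_spec toricX basI iI; rewrite scaler0.
have aE : a = - b by apply/eqP; rewrite -addr_eq0; apply/eqP.
have a0 : a = 0.
  by apply: (kerB_kerA_disjoint toricX aB); rewrite aE mulNmx bA oppr0.
have b0 : b = 0 by apply: oppr_inj; rewrite -aE a0 oppr0.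
move: v0; apply/negP; rewrite negbK; apply/eqP/rowP => i; rewrite mxE.
have [iI|iI] := boolP (i \in I).
  have := congr1 (fun x : 'rV_n => x ord0 i) a0; rewrite /= /a summxE mxE.
  rewrite (bigD1 i) //= mxE /g iI; have [_ -> _ _] := alpha_spec toricX basI iI.
  rewrite mulr1 big1 ?addr0 // => k /andP[kI ki]; rewrite kI mxE.
  by have [_ _ aI _] := alpha_spec toricX basI kI; rewrite aI ?mulr0 // eq_sym.
have := congr1 (fun x : 'rV_n => x ord0 i) b0; rewrite /= /b summxE mxE.
rewrite (bigD1 i) //= mxE /g (negPf iI); have [_ -> _ _ _] := beta_spec toricX basI iI.
rewrite mulr1 big1 ?addr0 // => k /andP[kI ki]; rewrite (negPf kI) mxE.
by have [_ _ bI _ _] := beta_spec toricX basI kI; rewrite bI ?mulr0 // eq_sym.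
Qed.

Variable lift : 'rV[int]_n -> 'rV[int]_n.
Hypothesis liftP : is_lift X lift.

(** Reducing the coordinates of x modulo the exponent N of the quotient does not
    change the class of x. *)
Lemma finite_range_lift (I : {set 'I_n}) : is_basis A I -> finite_set (range lift).
Proof.
move=> /sum_lattice_exponent[N N0 NL].
pose rem (f : {ffun 'I_n -> 'I_(absz N).+1}) : 'rV[int]_n := \row_i (f i : nat)%:Z.
apply: (@sub_finite_set _ _ ((lift \o rem) @` setT)); last first.
  by apply: finite_image; exact: finite_finset.
move=> _ [x _ <-]; exists [ffun i => inord (absz (x ord0 i %% N)%Z)] => //=.
apply: liftP.2; rewrite (_ : _ - _ = - N *: (\row_i (x ord0 i %/ N)%Z)).
  rewrite scaleNr; exact/in_sum_latticeN/NL.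
apply/rowP => i; rewrite !mxE ffunE.
have h0 := modz_ge0 (x ord0 i) N0; have h1 := ltz_mod (x ord0 i) N0.
have e := divz_eq (x ord0 i) N.
rewrite inordK; last by lia.
rewrite gez0_abs // {2}e; ring.
Qed.

Lemma lift_range_eq l l' : range lift l -> range lift l' ->
  in_sum_lattice X (l - l') -> l = l'.
Proof.
have idem x : lift (lift x) = lift x by apply/esym/liftP.2; exact: liftP.1.
by move=> [x _ <-] [y _ <-] /liftP.2; rewrite !idem.
Qed.

Lemma lift_decomposition x : exists l a b,
  [/\ range lift l, a *m B = 0, b *m A = 0 & x = l + a + b].
Proof.
have [a [b [aB bA e]]] := liftP.1 x; exists (lift x), a, b.
by split=> //; rewrite -addrA -e addrC subrK.
Qed.

Lemma lift_decomposition_unique l l' a a' b b' :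
  range lift l -> range lift l' -> a *m B = 0 -> a' *m B = 0 ->
  b *m A = 0 -> b' *m A = 0 -> l + a + b = l' + a' + b' ->
  [/\ l = l', a = a' & b = b'].
Proof.
move=> hl hl' aB aB' bA bA' e.
have ll : l = l'.
  apply: lift_range_eq => //; exists (a' - a), (b' - b).
  rewrite !mulmxBl aB aB' bA bA' !subrr; split=> //.
  have e' : a' + b' = l + (a + b) - l' by rewrite addrA e -(addrA l') [RHS]addrC addKr.
  by rewrite addrACA -opprD e' [RHS]addrAC addrK.
have ab : a - a' = b' - b.
  have e' : a + b = a' + b' by apply: (@addrI _ l); rewrite !addrA e ll.
  by apply/eqP; rewrite subr_eq addrAC (addrC b') -e' addrK.
have z : a - a' = 0.
  apply: (kerB_kerA_disjoint toricX); first by rewrite mulmxBl aB aB' subrr.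
  by rewrite ab mulmxBl bA bA' subrr.
split=> //; first by apply/eqP; rewrite -subr_eq0 z.
by apply/esym/eqP; rewrite -subr_eq0 -ab z.
Qed.

End Lifts.

(** * Weights of the line bundles at the fixed points *)

Section RestrictedWeights.
Local Open Scope set_scope.
Variables n d r : nat.
Variable X : hk_data n d r.
Hypothesis toricX : toric_hk X.
Local Notation A := (amx X).
Local Notation B := (bmx X).
Implicit Types (lam x y : 'rV[int]_n) (w : weight n).

Lemma weight_eq w w' : w.1.1 = w'.1.1 -> w.1.2 = w'.1.2 -> w.2 = w'.2 -> w = w'.
Proof. by case: w w' => [[m x] y] [[m' x'] y'] /= -> -> ->. Qed.

Lemma weight_lattice0 : weight_lattice X 0.
Proof. by split; rewrite mul0mx. Qed.

Lemma weight_latticeD w w' :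
  weight_lattice X w -> weight_lattice X w' -> weight_lattice X (w + w').
Proof. by move=> [a b] [a' b']; split; rewrite mulmxDl ?a ?a' ?b ?b' addr0. Qed.

Lemma weight_latticeN w : weight_lattice X w -> weight_lattice X (- w).
Proof. by move=> [a b]; split; rewrite mulNmx ?a ?b oppr0. Qed.

Lemma weight_lattice_vexp m : weight_lattice X (vexp n m).
Proof. by split; rewrite mul0mx. Qed.

Lemma weight_lattice_aexp x : x *m B = 0 -> weight_lattice X (aexp x).
Proof. by move=> xB; split; rewrite /= ?mul0mx. Qed.

Lemma weight_lattice_zexp y : y *m A = 0 -> weight_lattice X (zexp y).
Proof. by move=> yA; split; rewrite /= ?mul0mx. Qed.

Lemma vexpD m m' : vexp n (m + m') = vexp n m + vexp n m'.
Proof. by apply: weight_eq; rewrite /= ?addr0. Qed.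

Lemma vexpN m : vexp n (- m) = - vexp n m.
Proof. by apply: weight_eq; rewrite /= ?oppr0. Qed.

Lemma aexpD x y : aexp (x + y) = aexp x + aexp y.
Proof. by apply: weight_eq; rewrite /= ?addr0. Qed.

Lemma zexpD x y : zexp (x + y) = zexp x + zexp y.
Proof. by apply: weight_eq; rewrite /= ?addr0. Qed.

Let sum_dotD (D : {set 'I_n}) (f : 'I_n -> 'rV[int]_n) x y :
  \sum_(j in D) dot (x + y) (f j) = \sum_(j in D) dot x (f j) + \sum_(j in D) dot y (f j).
Proof. by rewrite -big_split; apply: eq_bigr => j _; rewrite dotDl. Qed.

Let sum_dot_epsD (D : {set 'I_n}) (f : 'I_n -> 'rV[int]_n) x y :
  \sum_(j in D) dot (x + y) (f j) *: eps j =
  \sum_(j in D) dot x (f j) *: eps j + \sum_(j in D) dot y (f j) *: eps j.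
Proof. by rewrite -big_split; apply: eq_bigr => j _; rewrite dotDl scalerDl. Qed.

Lemma LresD J x y : Lres X J (x + y) = Lres X J x + Lres X J y.
Proof.
rewrite /Lres !sum_dotD sum_dot_epsD [RHS]addrACA -vexpD -aexpD.
by rewrite !opprD; congr (vexp n _ + aexp _); rewrite addrACA.
Qed.

Lemma LdresD I x y : Ldres X I (x + y) = Ldres X I x + Ldres X I y.
Proof.
rewrite /Ldres !sum_dotD sum_dot_epsD [RHS]addrACA -vexpD -zexpD.
by rewrite !opprD; congr (vexp n _ + zexp _); rewrite addrACA.
Qed.

Lemma Lres0 J : Lres X J 0 = 0.
Proof. by apply: (@addrI _ (Lres X J 0)); rewrite -LresD !addr0. Qed.

Lemma Ldres0 I : Ldres X I 0 = 0.
Proof. by apply: (@addrI _ (Ldres X I 0)); rewrite -LdresD !addr0. Qed.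

Lemma LresN J x : Lres X J (- x) = - Lres X J x.
Proof. by apply/eqP; rewrite -addr_eq0 -LresD addNr Lres0. Qed.

Lemma LdresN I x : Ldres X I (- x) = - Ldres X I x.
Proof. by apply/eqP; rewrite -addr_eq0 -LdresD addNr Ldres0. Qed.

Section AtBasis.
Variable I : {set 'I_n}.
Hypothesis basI : is_basis A I.

Lemma weight_lattice_Lres lam : weight_lattice X (Lres X I lam).
Proof.
apply: weight_latticeD; first exact: weight_lattice_vexp.
apply: weight_lattice_aexp; rewrite kerB_projection //.
rewrite mulmx_suml big1 // => i iI; rewrite -scalemxAl.
by have [-> _ _ _] := alpha_spec toricX basI iI; rewrite scaler0.
Qed.

Lemma weight_lattice_Ldres lam : weight_lattice X (Ldres X I lam).
Proof.
apply: weight_latticeD; first exact: weight_lattice_vexp.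
apply: weight_lattice_zexp; rewrite kerA_projection //.
rewrite mulmx_suml big1 // => i; rewrite inE => iI; rewrite -scalemxAl.
by have [-> _ _ _ _] := beta_spec toricX basI iI; rewrite scaler0.
Qed.

(** The v-degree and the correction in the a-degree vanish, both being made of
    inner products with vectors of the orthogonal sublattice. *)
Lemma Lres_kerB a : a *m B = 0 -> Lres X I a = aexp a.
Proof.
move=> aB; have z j : j \notin I -> dot a (beta X I j) = 0.
  by move=> jI; have [bA _ _ _ _] := beta_spec toricX basI jI; exact: kerB_kerA_orthogonal bA.
rewrite /Lres !big1; first by apply: weight_eq; rewrite /= ?subr0 ?addr0 ?add0r.
- by move=> j; rewrite inE => /z ->; rewrite scale0r.
- by move=> j; rewrite !inE => /andP[/z].
- by move=> j; rewrite !inE => /andP[/z].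
Qed.

Lemma Ldres_kerA b : b *m A = 0 -> Ldres X I b = zexp b.
Proof.
move=> bA; have z i : i \in I -> dot b (alpha X I i) = 0.
  move=> iI; have [aB _ _ _] := alpha_spec toricX basI iI.
  by rewrite dotC; exact: kerB_kerA_orthogonal bA.
rewrite /Ldres !big1; first by apply: weight_eq; rewrite /= ?subr0 ?addr0 ?add0r.
- by move=> j /z ->; rewrite scale0r.
- by move=> j; rewrite !inE => /andP[/z].
- by move=> j; rewrite !inE => /andP[/z].
Qed.

Lemma mem_Ip i : i \in Ip X I -> i \in I.
Proof. by rewrite inE => /andP[]. Qed.

Lemma mem_Im i : (i \in Defs.Im X I) = (i \in I) && (i \notin Ip X I).
Proof.
rewrite !inE; case iI: (i \in I) => //=; have [_ _ _] := alpha_spec toricX basI iI.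
by move: (pairing _ _ _) => t; lia.
Qed.

Lemma mem_Icp j : j \in Icp X I -> j \notin I.
Proof. by rewrite !inE => /andP[]. Qed.

Lemma mem_Icm j : (j \in Icm X I) = (j \notin I) && (j \notin Icp X I).
Proof.
rewrite !inE; case jI: (j \in I) => //=.
have [_ _ _ _] := beta_spec toricX basI (negbT jI).
by move: (pairing _ _ _) => t; lia.
Qed.

Lemma prod_fixed_point_signs (S : comNzRingType) (F : 'I_n -> S) :
  \prod_i F i = \prod_(i in Ip X I) F i * \prod_(i in Defs.Im X I) F i *
    \prod_(j in Icp X I) F j * \prod_(j in Icm X I) F j.
Proof.
rewrite (bigID (mem I)) /= -mulrA; congr (_ * _).
  rewrite (bigID (mem (Ip X I))) /=; congr (_ * _); apply: eq_bigl => i.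
    by apply/andP/idP => [[]|iI] //; split=> //; exact: mem_Ip.
  by rewrite mem_Im.
rewrite (bigID (mem (Icp X I))) /=; congr (_ * _); apply: eq_bigl => i.
  by apply/andP/idP => [[]|iI] //; split=> //; exact: mem_Icp.
by rewrite mem_Icm.
Qed.

Let vdeg j : int :=
  \sum_(i in Ip X I) alpha X I i ord0 j - \sum_(i in Defs.Im X I) alpha X I i ord0 j.

Lemma Ldres_eps j : Ldres X I (eps j) =
  vexp n (vdeg j) + zexp (if j \in I then 0 else beta X I j).
Proof.
rewrite /Ldres kerA_projection // /vdeg; congr (vexp n (_ - _) + zexp _).
- by apply: eq_bigr => i _; rewrite dot_eps.
- by apply: eq_bigr => i _; rewrite dot_eps.
under eq_bigr => k _ do rewrite epsE.
have [jI|jI] := boolP (j \in I).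
  rewrite big1 // => k; rewrite inE => kI; case: eqP => [kj|_]; last by rewrite scale0r.
  by rewrite kj jI in kI.
rewrite (bigD1 j) ?inE //= eqxx scale1r big1 ?addr0 // => k /andP[_ /negPf ->].
by rewrite scale0r.
Qed.

Lemma Ldres_eps_Ip i : i \in Ip X I -> Ldres X I (eps i) = vexp n 1.
Proof.
move=> iIp; have iI := mem_Ip iIp; rewrite Ldres_eps iI /vdeg.
rewrite (bigD1 i) //= big1 => [|k /andP[/mem_Ip kI ki]]; last first.
  by have [_ _ aI _] := alpha_spec toricX basI kI; rewrite aI // eq_sym.
rewrite big1 => [|k]; last first.
  rewrite mem_Im => /andP[kI kIp]; have [_ _ aI _] := alpha_spec toricX basI kI.
  by rewrite aI //; apply: contraNneq kIp => <-.
by have [_ -> _ _] := alpha_spec toricX basI iI; rewrite addr0 subr0 addr0.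
Qed.

Lemma Ldres_eps_Im i : i \in Defs.Im X I -> Ldres X I (eps i) = vexp n (-1).
Proof.
move=> iIm; have := iIm; rewrite mem_Im => /andP[iI iIp]; rewrite Ldres_eps iI /vdeg.
rewrite big1 => [|k kIp]; last first.
  have [_ _ aI _] := alpha_spec toricX basI (mem_Ip kIp).
  by rewrite aI //; apply: contraNneq iIp => ->.
rewrite (bigD1 i) //= big1 => [|k /andP[]]; last first.
  rewrite mem_Im => /andP[kI _] ki; have [_ _ aI _] := alpha_spec toricX basI kI.
  by rewrite aI // eq_sym.
by have [_ -> _ _] := alpha_spec toricX basI iI; rewrite addr0 sub0r addr0.
Qed.

(** As beta_j lies in Ker A, its pairing with u *m B is its inner product
    with u. *)
Lemma lpairE j : j \notin I ->
  lpair X I j = dot (kappa n) (beta X I j)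
    + \sum_(i in Ip X I) beta X I j ord0 i - \sum_(i in Defs.Im X I) beta X I j ord0 i.
Proof.
move=> jI; have [bA _ _ _ _] := beta_spec toricX basI jI.
have sumE (D : {set 'I_n}) : \sum_(i in D) beta X I j ord0 i
    = dot (\sum_(i in D) eps i) (beta X I j).
  by rewrite dot_suml; apply: eq_bigr => i _; rewrite dot_eps.
rewrite !sumE -dotDl -dotNl -dotDl.
have rowE' (D : {set 'I_n}) : \sum_(i in D) row i B = (\sum_(i in D) eps i) *m B.
  by rewrite mulmx_suml; apply: eq_bigr => i _; rewrite rowE.
rewrite /lpair !rowE' -mulmxDl -mulmxBl /pairing /dot; set x := _ - _.
have [y yP] := kerA_imB toricX bA.
have := xgetPex 0 (ex_intro [set y : 'rV_r | beta X I j = y *m B^T]%classic y yP).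
move: (xget _ _) => z /= ->.
by rewrite trmx_mul trmxK mulmxA.
Qed.

Lemma Ldres_eps_notin j : j \notin I ->
  Ldres X I (eps j) = vexp n (dot (kappa n) (beta X I j) - lpair X I j) + zexp (beta X I j).
Proof.
move=> jI; rewrite Ldres_eps (negPf jI); congr (vexp n _ + _).
rewrite lpairE // /vdeg.
rewrite (eq_bigr (fun i => - beta X I j ord0 i)) => [|i /mem_Ip iI]; last by rewrite alpha_beta.
rewrite [X in _ - X](eq_bigr (fun i => - beta X I j ord0 i)) => [|i]; last first.
  by rewrite mem_Im => /andP[iI _]; rewrite alpha_beta.
by rewrite !sumrN; ring.
Qed.

End AtBasis.

End RestrictedWeights.

(** * The stable basis as a product of theta functions *)

Section HalfPoints.
Local Open Scope set_scope.
Variables (R : realType) (n d r : nat).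
Variable X : hk_data n d r.
Hypothesis toricX : toric_hk X.
Local Notation A := (amx X).
Local Notation B := (bmx X).
Variables (q : CC R) (p : weight n -> CC R).
Hypothesis pP : half_point X p.
Implicit Types (lam x y : 'rV[int]_n) (w : weight n).

Lemma half_point_neq0 w : weight_lattice X w -> p w != 0.
Proof. exact: pP.1. Qed.

Lemma half_pointD w w' : weight_lattice X w -> weight_lattice X w' ->
  p (w + w') = p w * p w'.
Proof. exact: pP.2. Qed.

Lemma half_point0 : p 0 = 1.
Proof.
have w0 := weight_lattice0 X; have := half_pointD w0 w0; rewrite addr0 => e.
by apply: (mulfI (half_point_neq0 w0)); rewrite mulr1 -e.
Qed.

Lemma half_pointN w : weight_lattice X w -> p (- w) = (p w)^-1.
Proof.
move=> wL; apply: (mulfI (half_point_neq0 wL)).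
rewrite mulfV ?half_point_neq0 // -half_pointD ?addrN ?half_point0 //.
exact: weight_latticeN.
Qed.

Lemma monoD w w' : weight_lattice X w -> weight_lattice X w' ->
  mono (w + w') p = mono w p * mono w' p.
Proof. by move=> wL wL'; rewrite /mono half_pointD // exprMn. Qed.

Lemma mono_neq0 w : weight_lattice X w -> mono w p != 0.
Proof. by move=> wL; rewrite /mono expf_neq0 // half_point_neq0. Qed.

Lemma theta_opp w : weight_lattice X w -> theta q (- w) p = - theta q w p.
Proof.
move=> wL; rewrite /theta /mono half_pointN // invrK -mulNr opprB; congr (_ * _).
rewrite (_ : (fun N : nat => _) = fun N : nat => \prod_(1 <= m < N.+1)
  ((1 - q ^+ m * p w ^+ 2) * (1 - q ^+ m * (p w ^+ 2)^-1))) //.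
by apply/funext => N; apply: eq_bigr => m _; rewrite exprVn invrK mulrC.
Qed.

Lemma theta_tau w : theta q w (tau p) = theta q (w + vexp n (dot (kappa n) w.2)) p.
Proof. by []. Qed.

Lemma snd_Lres (J : {set 'I_n}) lam m : (vexp n m + Lres X J lam).2 = 0.
Proof. by rewrite /= !addr0. Qed.

Lemma theta_tau_z0 w : w.2 = 0 -> theta q w (tau p) = theta q w p.
Proof. by move=> w0; rewrite theta_tau w0 dot0r [vexp n 0]/(0 : weight n) addr0. Qed.

Variables (I J : {set 'I_n}).
Hypotheses (basI : is_basis A I) (basJ : is_basis A J).

(** For lam = eps_i this is the monomial w_i on which both sides depend. *)
Definition pair_weight lam : weight n := Lres X J lam + Ldres X I lam.

Lemma weight_lattice_pair lam : weight_lattice X (pair_weight lam).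
Proof.
by apply: weight_latticeD; [exact: weight_lattice_Lres|exact: weight_lattice_Ldres].
Qed.

Lemma pair_weightD x y : pair_weight (x + y) = pair_weight x + pair_weight y.
Proof. by rewrite /pair_weight LresD LdresD addrACA. Qed.

Lemma pair_weight0 : pair_weight 0 = 0.
Proof. by rewrite /pair_weight Lres0 Ldres0 addr0. Qed.

Lemma pair_weightN x : pair_weight (- x) = - pair_weight x.
Proof. by rewrite /pair_weight LresN LdresN [RHS]opprD. Qed.

Lemma half_point_pair lam :
  p (pair_weight lam) = \prod_i p (pair_weight (eps i)) ^ lam ord0 i.
Proof.
have epsZ i (t : int) : p (pair_weight (t *: eps i)) = p (pair_weight (eps i)) ^ t.
  have wL := weight_lattice_pair.
  have nat (m : nat) : p (pair_weight (m%:Z *: eps i)) = p (pair_weight (eps i)) ^+ m.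
    elim: m => [|m IH]; first by rewrite scale0r pair_weight0 half_point0.
    rewrite (_ : m.+1%:Z = m%:Z + 1) ?scalerDl ?scale1r; last by lia.
    by rewrite pair_weightD (half_pointD (wL _) (wL _)) IH exprSr.
  case: t => m; first by rewrite nat.
  by rewrite NegzE scaleNr pair_weightN (half_pointN (wL _)) nat.
rewrite {1}(rV_eps lam).
elim/big_ind2: _ => [|x u y v <- <-|i _]; first by rewrite pair_weight0 half_point0.
  by rewrite pair_weightD half_pointD //; exact: weight_lattice_pair.
exact: epsZ.
Qed.

Lemma theta_Ip i : i \in Ip X I ->
  theta q (vexp n (-1) + Lres X J (- eps i)) (tau p) = - theta q (pair_weight (eps i)) p.
Proof.
move=> iI; rewrite -(theta_opp (weight_lattice_pair _)) theta_tau_z0 ?snd_Lres ?addr0 //.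
by rewrite /pair_weight (Ldres_eps_Ip toricX basI iI) LresN vexpN -opprD addrC.
Qed.

Lemma theta_Im i : i \in Defs.Im X I ->
  theta q (vexp n (-1) + Lres X J (eps i)) (tau p) = theta q (pair_weight (eps i)) p.
Proof.
move=> iI; rewrite theta_tau_z0 ?snd_Lres ?addr0 //.
by rewrite /pair_weight (Ldres_eps_Im toricX basI iI) addrC.
Qed.

(** The shift tau absorbs the kappa-part of l_j, after which the numerator is
    theta(w_j) and the denominator is theta of v L^!(eps_j), opposite to the
    factor of j in theta(N^!_{p^!_I, -}). *)
Lemma theta_Icp j : j \in Icp X I ->
  theta q (vexp n (lplus X I j) + zexp (beta X I j)) (tau p) != 0 ->
  theta q (vexp n (-1) + Ldres X I (- eps j)) p *
  (theta q (vexp n (lplus X I j - 1) + zexp (beta X I j) + Lres X J (eps j)) (tau p)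
   / theta q (vexp n (lplus X I j) + zexp (beta X I j)) (tau p)) =
  - theta q (pair_weight (eps j)) p.
Proof.
move=> jI; have jI' := mem_Icp jI; set b := beta X I j.
have E := Ldres_eps_notin toricX basI jI'.
have -> : theta q (vexp n (lplus X I j) + zexp b) (tau p) =
    - theta q (vexp n (-1) + Ldres X I (- eps j)) p.
  rewrite -theta_opp; last first.
    by apply: weight_latticeD; [exact: weight_lattice_vexp|exact: weight_lattice_Ldres].
  rewrite theta_tau LdresN E /lplus -/b; congr (theta q _ p).
  by apply: weight_eq; rewrite /= ?oppr0 ?addr0 ?add0r ?opprD ?opprK //; ring.
have -> : theta q (vexp n (lplus X I j - 1) + zexp b + Lres X J (eps j)) (tau p) =
    theta q (pair_weight (eps j)) p.
  rewrite theta_tau /pair_weight E /lplus -/b; congr (theta q _ p).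
  by apply: weight_eq; rewrite /= ?oppr0 ?addr0 ?add0r //; ring.
move: (theta _ _ _) (theta _ _ _) => u v; rewrite oppr_eq0 => u0.
by rewrite invrN mulrN mulrN mulrCA mulfV // mulr1.
Qed.

(** Here the numerator is theta(w_j^-1); its sign cancels that of the
    denominator. *)
Lemma theta_Icm j : j \in Icm X I ->
  theta q (vexp n (- lminus X I j) + zexp (- beta X I j)) (tau p) != 0 ->
  theta q (vexp n (-1) + Ldres X I (eps j)) p *
  (theta q (vexp n (- lminus X I j - 1) + zexp (- beta X I j) + Lres X J (- eps j)) (tau p)
   / theta q (vexp n (- lminus X I j) + zexp (- beta X I j)) (tau p)) =
  theta q (pair_weight (eps j)) p.
Proof.
rewrite mem_Icm // => /andP[jI _]; set b := beta X I j.
have E := Ldres_eps_notin toricX basI jI.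
have -> : theta q (vexp n (- lminus X I j) + zexp (- b)) (tau p) =
    - theta q (vexp n (-1) + Ldres X I (eps j)) p.
  rewrite -theta_opp; last first.
    by apply: weight_latticeD; [exact: weight_lattice_vexp|exact: weight_lattice_Ldres].
  rewrite theta_tau E /lminus -/b; congr (theta q _ p).
  by apply: weight_eq; rewrite /= ?(oppr0, addr0, add0r, dotNr) //; ring.
have -> : theta q (vexp n (- lminus X I j - 1) + zexp (- b) + Lres X J (- eps j)) (tau p) =
    - theta q (pair_weight (eps j)) p.
  rewrite -theta_opp; last exact: weight_lattice_pair.
  rewrite theta_tau /pair_weight LresN E /lminus -/b; congr (theta q _ p).
  by apply: weight_eq; rewrite /= ?(oppr0, addr0, add0r, dotNr) //; ring.
move: (theta _ _ _) (theta _ _ _) => u v; rewrite oppr_eq0 => u0.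
by rewrite invrN mulrNN mulrCA mulfV // mulr1.
Qed.

Lemma frakS_theta : regular_at X q I p ->
  (-1) ^+ (#|Ip X I| + #|Icp X I|) * frakS X q I J p =
  \prod_i ((p (pair_weight (eps i)))^-1 * theta q (pair_weight (eps i)) p).
Proof.
move=> [regp regm]; rewrite big_split /= (prodfV _ _ (fun i => p (pair_weight (eps i)))).
have -> : \prod_i p (pair_weight (eps i)) = p (pair_weight (kappa n)).
  by rewrite half_point_pair; apply: eq_bigr => i _; rewrite mxE expr1z.
rewrite /frakS -/(pair_weight _) mulrCA; congr (_ * _).
pose th i := theta q (pair_weight (eps i)) p.
rewrite [RHS](prod_fixed_point_signs toricX basI th).
pose a1 := \prod_(i in Ip X I) theta q (vexp n (-1) + Lres X J (- eps i)) (tau p).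
pose a2 := \prod_(i in Defs.Im X I) theta q (vexp n (-1) + Lres X J (eps i)) (tau p).
pose u1 := \prod_(j in Icp X I) theta q (vexp n (-1) + Ldres X I (- eps j)) p.
pose u2 := \prod_(j in Icp X I)
  (theta q (vexp n (lplus X I j - 1) + zexp (beta X I j) + Lres X J (eps j)) (tau p)
   / theta q (vexp n (lplus X I j) + zexp (beta X I j)) (tau p)).
pose v1 := \prod_(j in Icm X I) theta q (vexp n (-1) + Ldres X I (eps j)) p.
pose v2 := \prod_(j in Icm X I)
  (theta q (vexp n (- lminus X I j - 1) + zexp (- beta X I j) + Lres X J (- eps j)) (tau p)
   / theta q (vexp n (- lminus X I j) + zexp (- beta X I j)) (tau p)).
have -> : Stabell X q I J p = u1 * v1 * (a1 * a2 * u2 * v2) by [].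
have eIp : a1 = (-1) ^+ #|Ip X I| * \prod_(i in Ip X I) th i.
  by rewrite -prodrN; exact: eq_bigr theta_Ip.
have eIm : a2 = \prod_(i in Defs.Im X I) th i by exact: eq_bigr theta_Im.
have eIcp : u1 * u2 = (-1) ^+ #|Icp X I| * \prod_(j in Icp X I) th j.
  by rewrite -prodrN -big_split; apply: eq_bigr => j jI; exact: theta_Icp jI (regp j jI).
have eIcm : v1 * v2 = \prod_(j in Icm X I) th j.
  by rewrite -big_split; apply: eq_bigr => j jI; exact: theta_Icm jI (regm j jI).
rewrite eIp eIm; move: u1 u2 v1 v2 eIcp eIcm {a1 a2 eIp eIm}.
move: (\prod_(i in Ip X I) th i) (\prod_(i in Defs.Im X I) th i) => P1 P2.
move: (\prod_(j in Icp X I) th j) (\prod_(j in Icm X I) th j) => Pp Pm.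
move=> u1 u2 v1 v2 eIcp eIcm.
have s k : ((-1) ^+ k * (-1) ^+ k : CC R) = 1 by rewrite -exprMn mulrNN mulr1 expr1n.
rewrite exprD; move: eIcp (s #|Ip X I|) (s #|Icp X I|).
move: ((-1) ^+ #|Ip X I|) ((-1) ^+ #|Icp X I|) => s1 s2 eIcp s11 s22.
have -> : s1 * s2 * (u1 * v1 * (s1 * P1 * P2 * u2 * v2)) =
    (s1 * s1) * s2 * (u1 * u2) * (v1 * v2) * (P1 * P2) by ring.
rewrite eIcp eIcm s11 mul1r (mulrA s2) s22 mul1r; ring.
Qed.

End HalfPoints.

(** * The sum of products of theta series *)

Section HalfNorm.
Variable n : nat.
Implicit Types x y a b : 'rV[int]_n.

(** The parity that makes half_norm exact holds coordinatewise. *)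
Lemma half_norm_tri x : half_norm x = \sum_i tri (x ord0 i).
Proof.
have e : dot x (x + kappa n) = (\sum_i tri (x ord0 i)) * 2.
  by rewrite dotE mulr_suml; apply: eq_bigr => i _; rewrite tri2 !mxE.
by rewrite /half_norm e mulzK.
Qed.

Lemma half_norm2 x : half_norm x * 2 = dot x x + dot (kappa n) x.
Proof.
rewrite half_norm_tri mulr_suml !dotE -big_split; apply: eq_bigr => i _.
by rewrite tri2 [kappa n _ _]mxE mul1r mulrDr mulr1.
Qed.

Lemma half_normD x a b : dot a b = 0 ->
  half_norm (x + a + b) = half_norm x + (half_norm a + dot x a) + (half_norm b + dot x b).
Proof.
move=> ab; apply: (mulIf (_ : (2 : int) != 0)) => //.
rewrite !mulrDl !half_norm2 !(dotDl, dotDr) ab (dotC b a) ab (dotC a x) (dotC b x).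
ring.
Qed.

End HalfNorm.

Lemma exprz_sum (F : fieldType) (T : Type) (s : seq T) (f : T -> int) (x : F) :
  x != 0 -> x ^ (\sum_(i <- s) f i) = \prod_(i <- s) x ^ f i.
Proof.
move=> x0; apply: (big_morph (fun m : int => x ^ m)) => [m m'|]; last exact: expr0z.
exact: expfzDr.
Qed.

Section ThetaProduct.
Variables (R : realType) (n d r : nat).
Variable X : hk_data n d r.
Hypothesis toricX : toric_hk X.
Local Notation A := (amx X).
Local Notation B := (bmx X).
Variables (q : CC R) (p : weight n -> CC R).
Hypotheses (q_neq0 : q != 0) (q_lt1 : cabs q < 1).
Hypothesis pP : half_point X p.
Variables (I J : {set 'I_n}).
Hypotheses (basI : is_basis A I) (basJ : is_basis A J).
Implicit Types (lam a b x : 'rV[int]_n).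

Let W := pair_weight X I J.

Definition lattice_term x : CC R := \prod_i jterm q (p (W (eps i)) ^+ 2) (x ord0 i).

Lemma lattice_termE x :
  lattice_term x = (-1) ^ dot (kappa n) x * q ^ half_norm x * mono (W x) p.
Proof.
rewrite /lattice_term /jterm !big_split /=; congr (_ * _ * _).
- rewrite -exprz_sum ?oppr_eq0 ?oner_eq0 //; congr (_ ^ _).
  by rewrite dotE; apply: eq_bigr => i _; rewrite mxE mul1r.
- by rewrite -exprz_sum // half_norm_tri.
rewrite /mono /W (half_point_pair toricX pP basI basJ) -prodrXl; apply: eq_bigr => i _.
by rewrite exprnP exprzAC.
Qed.

(** The term at lam + a + b is a product of a term of Theta_{X^!}(lam) and a
    term of Theta_X(lam): the quadratic exponent has no (a, b) cross term, and
    L(a), L^!(b) restrict to the monomials aexp a, zexp b of the other series. *)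
Lemma lattice_term_split lam a b : a *m B = 0 -> b *m A = 0 ->
  lattice_term (lam + a + b) =
    ((-1) ^ dot (kappa n) lam * q ^ half_norm lam) *
    ((-1) ^ dot (kappa n) a * q ^ (half_norm a + dot lam a)
      * mono (Ldres X I (lam + a)) p * mono (aexp a) p) *
    ((-1) ^ dot (kappa n) b * q ^ (half_norm b + dot lam b)
      * mono (Lres X J (lam + b)) p * mono (zexp b) p).
Proof.
move=> aB bA; rewrite lattice_termE half_normD ?(kerB_kerA_orthogonal toricX aB bA) //.
have -> : W (lam + a + b) =
    Ldres X I (lam + a) + aexp a + (Lres X J (lam + b) + zexp b).
  have eI : Ldres X I (lam + a + b) = Ldres X I (lam + a) + zexp b.
    by rewrite [LHS]LdresD (Ldres_kerA toricX basI bA).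
  have eJ : Lres X J (lam + a + b) = Lres X J (lam + b) + aexp a.
    by rewrite (addrAC lam) [LHS]LresD (Lres_kerB toricX basJ aB).
  rewrite /W /pair_weight eI eJ.
  by rewrite [in LHS](addrC (Lres X J _)) [LHS]addrACA [in LHS](addrC (aexp a)).
rewrite !dotDr !expfzDr ?oppr_eq0 ?oner_eq0 //.
have wI := weight_lattice_Ldres toricX basI; have wJ := weight_lattice_Lres toricX basJ.
have wa := weight_lattice_aexp aB; have wb := weight_lattice_zexp bA.
rewrite (monoD pP (weight_latticeD (wI _) wa) (weight_latticeD (wJ _) wb)).
rewrite (monoD pP (wI _) wa) (monoD pP (wJ _) wb).
move: (mono _ _) (mono _ _) (mono _ _) (mono _ _) => m1 m2 m3 m4.
move: ((-1) ^ _) ((-1) ^ _) ((-1) ^ _) => s1 s2 s3.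
move: (q ^ _) (q ^ _) (q ^ _) (q ^ _) (q ^ _) => q1 q2 q3 q4 q5.
ring.
Qed.

Lemma lattice_term_neq0 x : lattice_term x != 0.
Proof.
rewrite lattice_termE; apply: mulf_neq0.
  by rewrite mulf_neq0 // expfz_neq0 // oppr_eq0 oner_eq0.
by apply: (mono_neq0 pP); exact: weight_lattice_pair.
Qed.

Lemma sum_theta_products lift : is_lift X lift ->
  \sum_(lam \in range lift)
    (-1) ^ dot (kappa n) lam * q ^ half_norm lam
    * ThetaXd_res X q I lam p * ThetaX X q lam J p =
  \prod_i ((p (W (eps i)))^-1 * theta q (W (eps i)) p).
Proof.
move=> liftP; have finL := finite_range_lift toricX liftP basI.
rewrite fsbig_finite //=.
set L := enum_fset _.
have LP l : l \in L <-> range lift l by rewrite in_fset_set // inE.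
have pW i : p (W (eps i)) != 0.
  by apply: (half_point_neq0 pP); exact: weight_lattice_pair.
have [tS tE] := lattice_product (fun i => jterm_abs_summable q_neq0 q_lt1 (expf_neq0 2 (pW i))).
pose c lam : CC R := (-1) ^ dot (kappa n) lam * q ^ half_norm lam.
pose f lam a : CC R := (-1) ^ dot (kappa n) a * q ^ (half_norm a + dot lam a)
      * mono (Ldres X I (lam + a)) p * mono (aexp a) p.
pose g lam b : CC R := (-1) ^ dot (kappa n) b * q ^ (half_norm b + dot lam b)
      * mono (Lres X J (lam + b)) p * mono (zexp b) p.
have split : summability.sum lattice_term =
    \sum_(l <- L) c l * sum_ker B (f l) * sum_ker A (g l).
  apply: (@sum_lattice_split _ _ _ _ A B _ L c f g tS).
  - exact: fset_uniq.
  - move=> x; have [l [a [b [hl aB bA e]]]] := lift_decomposition liftP x.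
    by exists l, a, b; split=> //; exact/LP.
  - move=> l l' a a' b b' /LP hl /LP hl'; exact: (lift_decomposition_unique toricX liftP hl hl').
  - by move=> l a b _ aB bA; exact: lattice_term_split.
  move=> l _; have := lattice_term_neq0 (l + 0 + 0).
  rewrite lattice_term_split ?mul0mx // mulf_eq0 negb_or => /andP[].
  by rewrite mulf_eq0 negb_or => /andP[].
transitivity (qpoch q ^- n * summability.sum lattice_term).
  rewrite split mulr_sumr; apply: eq_bigr => l _.
  have -> : qpoch q ^- n = qpoch q ^- d * qpoch q ^- r.
    by rewrite -invfM -exprD addnC (hk_dim toricX).
  rewrite /ThetaXd_res /ThetaX -/(f l) -/(g l) -/(c l).
  by move: (qpoch q ^- d) (qpoch q ^- r) (c l) (sum_ker B _) (sum_ker A _) => *; ring.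
have -> : qpoch q ^- n = \prod_(i < n) (qpoch q)^-1 by rewrite prodr_const card_ord exprVn.
rewrite tE -big_split; apply: eq_bigr => i _ /=.
rewrite jacobi_triple_product // /theta /mono.
have := qpoch_neq0 q_neq0 q_lt1; move: (qpoch q) (lim _) (pW i) => Q t s0 Q0.
by field; rewrite Q0 s0.
Qed.

End ThetaProduct.

Theorem theorem6p9 (R : realType) (n d r : nat) (X : hk_data n d r)
    (q : CC R) (lift : 'rV[int]_n -> 'rV[int]_n) (I : {set 'I_n}) :
  toric_hk X ->
  0 < `|q| -> `|q| < 1 ->
  is_lift X lift ->
  is_basis (amx X) I ->
  forall J : {set 'I_n}, is_basis (amx X) J ->
  forall p : int * 'rV[int]_n * 'rV[int]_n -> CC R,
  half_point X p -> regular_at X q I p ->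
  (-1) ^+ (#|Ip X I| + #|Icp X I|) * frakS X q I J p =
  \sum_(lam \in range lift)
    (-1) ^ dot (kappa n) lam * q ^ half_norm lam
    * ThetaXd_res X q I lam p * ThetaX X q lam J p.
Proof.
move=> toricX; rewrite normr_gt0 => q0; rewrite normE -[1]/(1%:C%C) ltcR => q1.
move=> liftP basI J basJ p pP pI.
rewrite (frakS_theta toricX pP basI basJ pI).
by rewrite (sum_theta_products toricX q0 q1 pP basI basJ liftP).
Qed.
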